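(* Let $1\le q\le2$, and let $0\le\alpha_0<\frac14$, $C^*>0$, $0\le\gamma<\frac12$, $\sigma_0>0$ be constants; let $c_0$ be the constant defined in the context. Suppose the sparsity levels $k,k_0$ satisfy $k\le c_0\min\{p^{\gamma},\frac{n}{\log p}\}$ and $k_0\le c_0\min\{k,\frac{\sqrt n}{\log p}\}$. Let $\widehat\beta$ be any estimator such that for some $\theta_0=(\beta^*,\mathrm I,\sigma_0)\in\Theta_0(k)$ with $\|\beta^*\|_0\le k_0$, $$\mathbb P_{\theta_0}\Big(\|\widehat\beta-\beta^*\|_q^2> C^*\|\beta^*\|_0^{2/q}\tfrac{\log p}{n}\sigma_0^2\Big)\le\alpha_0 .$$ Then $$\inf_{\widehat L_q}\sup_{\theta\in\Theta(k)}\mathbb P_\theta\Big(\big|\widehat L_q-\|\widehat\beta-\beta(\theta)\|_q^2\big|\ge c\,k^{2/q}\frac{\log p}{n}\Big)\ge\delta ,$$ where $\delta>0$ and $c>0$ are constants and the infimum is over all estimators (measurable functions of $Z$) of the loss.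
   Context: Model: one observes $Z=(X,y)$ with $y=X\beta+\epsilon$, $X\in\mathbb R^{n\times p}$ with i.i.d. rows $X_{i\cdot}\sim N_p(0,\Sigma)$, $\epsilon\sim N_n(0,\sigma^2\mathrm I)$ independent of $X$. The parameter is $\theta=(\beta,\Sigma,\sigma)$, with $\sigma>0$ the noise standard deviation; $\beta(\theta)$ is its first component and $\mathbb P_\theta$ the law of $Z$. An estimator $\widehat\beta$ is a measurable function of $Z$. $\|x\|_0$ is the number of nonzero coordinates of $x$. Parameter spaces: $\Theta_0(k)=\{(\beta,\mathrm I,\sigma_0):\|\beta\|_0\le k\}$ and $$\Theta(k)=\Big\{(\beta,\Sigma,\sigma):\|\beta\|_0\le k,\ \tfrac1{M_1}\le\lambda_{\min}(\Sigma)\le\lambda_{\max}(\Sigma)\le M_1,\ 0<\sigma\le M_2\Big\},$$ where $M_1\ge1$, $M_2>0$ are constants with $\sigma_0\le M_2$, so that $\Theta_0(k)\subset\Theta(k)$. Constant $c_0$: fix $0<\alpha<\frac14$, put $\epsilon_1=\frac{1-2\alpha-2\alpha_0}{12}$ and $$c_0=\min\Big\{\tfrac12,\;32\log(1+\epsilon_1^2),\;\tfrac23\sqrt{\log(1+\epsilon_1^2)},\;\tfrac{1-2\gamma}{16C^*},\;\big(\tfrac{1-2\gamma}{16C^*}\big)^2\Big\}.$$ Constants do not depend on $n,p$ or the sparsity levels (they may depend on $\alpha_0,C^*,\gamma,q,\sigma_0,M_1,M_2$). *)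

(* Defs.v *)
From HB Require Import structures.
From mathcomp Require Import all_boot all_order all_algebra.
From mathcomp Require Import all_classical all_reals all_analysis.
From mathcomp Require Import measurable_realfun.

Set Implicit Arguments.
Unset Strict Implicit.
Unset Printing Implicit Defensive.

Import Order.TTheory GRing.Theory Num.Theory.
Import numFieldNormedType.Exports.

Local Open Scope classical_set_scope.
Local Open Scope ring_scope.

Definition measure_matrix_display : measure_display -> measure_display.
Proof. exact. Qed.

(* The sigma-algebra on matrices generated by the entries, i.e. the product
   sigma-algebra (the Borel sigma-algebra when T is the real line). *)
Section measurable_matrix.
Context {d} {T : measurableType d} (m n : nat).

Definition matrix_measurable : set (set 'M[T]_(m, n)) :=
  <<s \bigcup_(ij in [set: 'I_m * 'I_n])
        preimage_set_system setT (fun A : 'M[T]_(m, n) => A ij.1 ij.2)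
          measurable >>.

Let matrix_set0 : matrix_measurable set0.
Proof. exact: sigma_algebra0. Qed.

Let matrix_setC A : matrix_measurable A -> matrix_measurable (~` A).
Proof. exact: sigma_algebraC. Qed.

Let matrix_bigcup (F : (set 'M[T]_(m, n))^nat) :
  (forall i, matrix_measurable (F i)) ->
  matrix_measurable (\bigcup_i (F i)).
Proof. exact: sigma_algebra_bigcup. Qed.

HB.instance Definition _ := @isMeasurable.Build (measure_matrix_display d)
  'M[T]_(m, n) matrix_measurable matrix_set0 matrix_setC matrix_bigcup.

End measurable_matrix.

Section measurable_matrix_lemmas.
Context {d} {T : measurableType d}.

Lemma measurable_entry m n (i : 'I_m) (j : 'I_n) :
  measurable_fun [set: 'M[T]_(m, n)] (fun A => A i j).
Proof.
move=> _ Y mY; rewrite setTI; apply: sub_sigma_algebra => /=.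
by exists (i, j) => //; exists Y => //; rewrite setTI.
Qed.

Lemma measurable_matrixP d' (T' : measurableType d') m n
    (f : T' -> 'M[T]_(m, n)) :
  measurable_fun [set: T'] f <->
  forall i j, measurable_fun [set: T'] (fun x => f x i j).
Proof.
split=> [mf i j|mf].
  exact: (measurableT_comp (measurable_entry i j) mf).
move=> _ Y mY; rewrite setTI.
pose G := [set A : set 'M[T]_(m, n) | measurable (f @^-1` A)].
suff: matrix_measurable (T := T) (m := m) (n := n) `<=` G by apply.
apply: smallest_sub.
  split=> [|A mA|F mF]; rewrite /G /=.
  - by rewrite preimage_set0.
  - by rewrite setTD preimage_setC; exact: measurableC.
  - by rewrite preimage_bigcup; exact: bigcupT_measurable.
move=> A [[i j] _ [B mB <-]]; rewrite /G /= setTI.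
by have := mf i j measurableT B mB; rewrite setTI.
Qed.

End measurable_matrix_lemmas.

Section iid.
Context {d} {T : measurableType d} {R : realType}.

Definition cons_tuple n (x : T * n.-tuple T) : n.+1.-tuple T :=
  [tuple of x.1 :: x.2].

Let measurable_cons_tuple n : measurable_fun setT (@cons_tuple n).
Proof. exact: measurable_cons. Qed.

HB.instance Definition _ n := isMeasurableFun.Build _ _ _ _
  (@cons_tuple n) (@measurable_cons_tuple n).

(* The n-fold product P \x ... \x P, i.e. the law of an i.i.d. n-sample of P. *)
Fixpoint iid (P : probability T R) n : probability (n.-tuple T) R :=
  if n is m.+1 then distribution (P \x iid P m)%E (@cons_tuple m)
  else dirac [tuple].

End iid.

Section model.
Context {R : realType}.

Section multivariate_normal.
Variable p : nat.

Definition is_psd_sqrt (Sigma S : 'M[R]_p) : Prop :=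
  [/\ S^T = S, forall u : 'cV_p, 0 <= (u^T *m S *m u) 0 0
    & S *m S = Sigma].

(* Sigma^(1/2), which is unique when it exists; the default value is only used
   when Sigma is not symmetric positive semidefinite. *)
Definition psd_sqrt (Sigma : 'M[R]_p) : 'M[R]_p :=
  xget 0 [set S | is_psd_sqrt Sigma S].

(* measurableTypeR R is R with the Borel sigma-algebra under the display used
   by normal_prob. *)
Definition tuple_lmap (A : 'M[R]_p) (t : p.-tuple (measurableTypeR R)) :
    'cV[R]_p :=
  A *m \col_i (tnth t i : R).

Let measurable_tuple_lmap A : measurable_fun setT (tuple_lmap A).
Proof.
apply/measurable_matrixP => i j; rewrite /tuple_lmap.
under eq_fun do rewrite mxE.
apply: measurable_sum => l; apply: measurable_funM => //.
under eq_fun do rewrite mxE.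
exact: measurable_tnth.
Qed.

HB.instance Definition _ A := isMeasurableFun.Build _ _ _ _
  (tuple_lmap A) (measurable_tuple_lmap A).

(* N_p(0, Sigma), as the law of Sigma^(1/2) g with g standard Gaussian. *)
Definition mvnormal (Sigma : 'M[R]_p) : probability 'cV[R]_p R :=
  distribution (iid (normal_prob 0 1) p) (tuple_lmap (psd_sqrt Sigma)).

End multivariate_normal.

Record param (p : nat) :=
  Param { beta : 'cV[R]_p ; Sigma : 'M[R]_p ; sigma : R }.

Section linear_model.
Variables n p : nat.

(* (X, y) with y = X b + e, where the rows of X are the vectors of w.1 and
   e = w.2. *)
Definition regression (b : 'cV[R]_p) (w : n.-tuple 'cV[R]_p * 'cV[R]_n) :
    'M[R]_(n, p) * 'cV[R]_n :=
  let X := \matrix_(i, j) tnth w.1 i j 0 in (X, X *m b + w.2).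

Let measurable_regression b : measurable_fun setT (regression b).
Proof.
have mX i j : measurable_fun setT
    (fun w : n.-tuple 'cV[R]_p * 'cV[R]_n => tnth w.1 i j 0).
  apply: (measurableT_comp (measurable_entry j 0)).
  exact: (measurableT_comp (measurable_tnth i) measurable_fst).
apply: measurable_fun_pair; apply/measurable_matrixP => i j.
  by under eq_fun do rewrite mxE; exact: mX.
under eq_fun do rewrite !mxE.
apply: measurable_funD.
  apply: measurable_sum => l; apply: measurable_funM => //.
  by under eq_fun do rewrite mxE; exact: mX.
exact: (measurableT_comp (measurable_entry i j) measurable_snd).
Qed.

HB.instance Definition _ b := isMeasurableFun.Build _ _ _ _
  (regression b) (measurable_regression b).

Definition model (theta : param p) :
    probability ('M[R]_(n, p) * 'cV[R]_n)%type R :=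
  distribution
    (iid (mvnormal (Sigma theta)) n \x mvnormal ((sigma theta ^+ 2)%:M))%E
    (regression (beta theta)).

End linear_model.

Section parameter_spaces.
Variable p : nat.

Definition l0norm (x : 'cV[R]_p) : nat := #|[set i | x i 0 != 0]|%SET.

Definition lqnorm (q : R) (x : 'cV[R]_p) : R :=
  (\sum_(i < p) `|x i 0| `^ q) `^ q^-1.

(* For p > 0 and S symmetric the set is finite and nonempty, so this is the
   least eigenvalue (dually for lambda_max). *)
Definition lambda_min (S : 'M[R]_p) : R := inf [set a | eigenvalue S a].

Definition lambda_max (S : 'M[R]_p) : R := sup [set a | eigenvalue S a].

Definition Theta0 (sigma0 : R) (k : nat) : set (param p) :=
  [set theta | [/\ (l0norm (beta theta) <= k)%N, Sigma theta = 1%:M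
    & sigma theta = sigma0]].

Definition Theta (M1 M2 : R) (k : nat) : set (param p) :=
  [set theta | [/\ (l0norm (beta theta) <= k)%N,
    (Sigma theta)^T = Sigma theta,
    M1^-1 <= lambda_min (Sigma theta),
    lambda_min (Sigma theta) <= lambda_max (Sigma theta) <= M1
    & 0 < sigma theta <= M2]].

End parameter_spaces.

Definition epsilon1 (alpha alpha0 : R) : R :=
  (1 - 2 * alpha - 2 * alpha0) / 12.

Definition c0 (alpha alpha0 Cstar gamma : R) : R :=
  let L := ln (1 + epsilon1 alpha alpha0 ^+ 2) in
  let r := (1 - 2 * gamma) / (16 * Cstar) in
  Num.min (1 / 2) (Num.min (32 * L)
    (Num.min (2 / 3 * Num.sqrt L) (Num.min r (r ^+ 2)))).

End model.

(* Main.v *)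
Require Import Defs.
From HB Require Import structures.
From mathcomp Require Import all_boot all_order all_algebra.
From mathcomp Require Import all_classical all_reals all_analysis.
From mathcomp Require Import measurable_realfun ring lra zify.

(* Fix an estimator [Lhat] of the loss and let [b] be the true vector at which
   [betahat] is accurate, with unit design covariance and noise level [sigma0].
   Plant a random spike: [f] picks one coordinate in each of [m] = k - k0 disjoint
   blocks of length [p %/ m], and the alternative is b + sigma0 * r * 1_S with S the
   picked set, r^2 = (1 - 2 gamma) / 2 * ln p / n, and noise level
   sigma0 * sqrt (1 - r^2 m), so that the residual y - X b keeps its law.  The
   likelihood ratios against the null satisfy E[L_S L_S'] = (1 - r^2 |S n S'|)^-n,
   which is at most p ^ ((1 - 2 gamma) |S n S'|).  As the picks in the blocks are
   independent, the average of this over S' is at most exp (2 c0^2), so the mixture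
   of the alternatives is nearly indistinguishable from the null.  But where the
   loss at [b] is small and [Lhat] approximates it, the loss at every alternative is
   of order k^(2/q) ln p / n, so [Lhat] misses it by that order. *)

Set Implicit Arguments.
Unset Strict Implicit.
Unset Printing Implicit Defensive.

Import Order.TTheory GRing.Theory Num.Theory.
Import numFieldNormedType.Exports.

Local Open Scope classical_set_scope.
Local Open Scope ring_scope.

(** * Gaussian integrals on the line *)

(* Density of N(t, s^2) with respect to N(0, 1). *)
Definition normal_lr {R : realType} (s t z : R) : R :=
  s^-1 * expR (z ^+ 2 / 2 - (z - t) ^+ 2 / (2 * s ^+ 2)).

Section gaussian.
Context {R : realType}.
Local Notation mu := (@lebesgue_measure R).
Local Notation G := (normal_prob (0 : R) 1).

(** Change of variables speaks of the Radon-Nikodym derivative. That derivative equals [normal_pdf]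
    almost everywhere, because both have the same integral over every measurable set. *)
Lemma ge0_integral_normal_prob (m s : R) (f : measurableTypeR R -> \bar R) :
  measurable_fun setT f -> (forall x, 0 <= f x)%E ->
  (\int[normal_prob m s]_x f x = \int[mu]_x (f x * (normal_pdf m s x)%:E))%E.
Proof.
move=> mf f0.
have dom := normal_prob_dominates m s.
rewrite -(Radon_Nikodym_SigmaFinite.change_of_variables dom)//.
have ig := Radon_Nikodym_SigmaFinite.f_integrable dom.
have mpdf : measurable_fun setT (fun x : measurableTypeR R => (normal_pdf m s x)%:E).
  by apply/measurable_EFinP; exact: measurable_normal_pdf.
apply: ge0_ae_eq_integral => //.
- by apply: emeasurable_funM => //; exact: measurable_int ig.
- exact: emeasurable_funM.
- by move=> x _; rewrite mule_ge0//; exact: Radon_Nikodym_SigmaFinite.f_ge0.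
- by move=> x _; rewrite mule_ge0// lee_fin normal_pdf_ge0.
- apply: ae_eqe_mul2l; apply: integral_ae_eq => //.
  by move=> A _ mA; rewrite -(Radon_Nikodym_SigmaFinite.f_integral dom).
Qed.

(** The pushforward of Lebesgue measure under x -> t + s x, scaled by s, agrees with Lebesgue
    measure on half-open intervals, hence everywhere by uniqueness. *)
Lemma ge0_integral_affine (t s : R) (f : measurableTypeR R -> \bar R) :
  0 < s -> measurable_fun setT f -> (forall x, 0 <= f x)%E ->
  (\int[mu]_x f x = s%:E * \int[mu]_x f (t + s * x)%R)%E.
Proof.
move=> s0 mf f0.
pose phi (x : measurableTypeR R) : measurableTypeR R := t + s * x.
have mphi : measurable_fun setT phi.
  by apply: measurable_funD => //; exact: measurable_funM.
pose nu : {measure set (measurableTypeR R) -> \bar R} := mscale (NngNum (ltW s0))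
  (measure_function_pushforward__canonical__measure_function_Measure mu mphi).
have nuE A : measurable A -> mu A = nu A.
  apply: lebesgue_measure_unique => _ [[a b]] _ <-.
  change (mu `]a, b] = s%:E * mu (phi @^-1` `]a, b]%classic))%E.
  have -> : phi @^-1` `]a, b] = `](a - t) / s, (b - t) / s]%classic.
    apply/seteqP; split=> x /=; rewrite !in_itv/= /phi ltr_pdivrMr// ler_pdivlMr//;
      rewrite (mulrC x) ltrBlDl lerBrDl//.
  rewrite !lebesgue_measure_itv/= !lte_fin ltr_pM2r ?invr_gt0// ltrD2r.
  case: ifPn => ab; last by rewrite mule0.
  by rewrite -!EFinB -EFinM; congr EFin; field; rewrite gt_eqF.
rewrite (eq_measure_integral nu); last by move=> A mA _; exact: nuE.
by rewrite ge0_integral_mscale//= ge0_integral_pushforward.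
Qed.

Lemma measurable_fun_normal_lr d (T : measurableType d) (s : R) (f g : T -> R) :
  measurable_fun setT f -> measurable_fun setT g ->
  measurable_fun setT (fun x => normal_lr s (f x) (g x)).
Proof.
move=> mf mg; apply: measurable_funM => //; apply: measurableT_comp => //.
apply: measurable_funB; apply: measurable_funM => //.
  exact: measurable_funX.
by apply: measurable_funX; exact: measurable_funB.
Qed.

Lemma measurable_normal_lr (s t : R) : measurable_fun setT
  (fun z : measurableTypeR R => normal_lr s t z).
Proof. by apply: (@measurable_fun_normal_lr _ _ s (fun=> t) id). Qed.

Lemma measurable_expR_quad (a b c : R) : measurable_fun setT
  (fun x : measurableTypeR R => (expR (- (a * x ^+ 2 - 2 * b * x + c) / 2))%:E).
Proof.
apply/measurable_EFinP; apply: measurableT_comp => //.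
apply: measurable_funM => //; apply: measurable_funN.
apply: measurable_funD => //; apply: measurable_funB; last exact: measurable_funM.
exact: measurable_funM.
Qed.

Lemma normal_pdf01E (x : R) : normal_pdf 0 1 x = normal_peak 1 * expR (- x ^+ 2 / 2).
Proof. by rewrite normal_pdfE ?oner_eq0// /normal_fun subr0 expr1n. Qed.

(** Completing the square turns the integrand times the standard normal density into a constant
    times the density of N(b / (1 + a), 1 / (1 + a)). Negative [a] above -1 does occur below. *)
Lemma integral_normal_expR_quad (a b c : R) : 0 < 1 + a ->
  (\int[G]_x (expR (- (a * x ^+ 2 - 2 * b * x + c) / 2))%:E =
   ((Num.sqrt (1 + a))^-1 * expR ((b ^+ 2 / (1 + a) - c) / 2))%:E)%E.
Proof.
move=> a0; rewrite ge0_integral_normal_prob; last 2 first.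
- exact: measurable_expR_quad.
- by move=> x; rewrite lee_fin expR_ge0.
set K := (Num.sqrt _)^-1 * _.
pose s := (Num.sqrt (1 + a))^-1.
have q0 : 0 < Num.sqrt (1 + a) by rewrite sqrtr_gt0.
have s0 : s != 0 by rewrite invr_neq0// gt_eqF.
transitivity (\int[mu]_x (K%:E * (normal_pdf (b / (1 + a)) s x)%:E))%E.
  apply: eq_integral => x _; rewrite -!EFinM; congr EFin.
  rewrite normal_pdf01E normal_pdfE// /normal_fun.
  have -> : normal_peak s = Num.sqrt (1 + a) * normal_peak (1 : R).
    rewrite /normal_peak expr1n mul1r -mulrnAr sqrtrM ?sqr_ge0//.
    by rewrite sqrtr_sqr gtr0_norm ?invr_gt0// invfM invrK.
  set E := expR (- (x - _) ^+ 2 / _); have -> : K * (Num.sqrt (1 + a) * normal_peak 1 * E) =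
      normal_peak 1 * (expR ((b ^+ 2 / (1 + a) - c) / 2) * E).
    by rewrite /K; field; rewrite gt_eqF.
  rewrite mulrCA -!expRD; congr (_ * expR _).
  rewrite /s exprVn sqr_sqrtr ?ltW// -mulr_natr; field.
  by rewrite gt_eqF.
rewrite ge0_integralZl//; first by rewrite integral_normal_pdf mule1.
- by apply/measurable_EFinP; exact: measurable_normal_pdf.
- by move=> x _; rewrite lee_fin normal_pdf_ge0.
- by rewrite lee_fin mulr_ge0 ?expR_ge0// invr_ge0 sqrtr_ge0.
Qed.

Lemma integral_normal_lr (t s : R) (f : measurableTypeR R -> \bar R) :
  0 < s -> measurable_fun setT f -> (forall x, 0 <= f x)%E ->
  (\int[G]_x f (t + s * x)%R = \int[G]_x (f x * (normal_lr s t x)%:E))%E.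
Proof.
move=> s0 mf f0.
have mpdf : measurable_fun setT (fun x : measurableTypeR R => (normal_pdf 0 1 x)%:E).
  by apply/measurable_EFinP; exact: measurable_normal_pdf.
have maff : measurable_fun setT (fun x : measurableTypeR R => (t + s * x : measurableTypeR R)).
  by apply: measurable_funD => //; exact: measurable_funM.
have mlr : measurable_fun setT (fun x : measurableTypeR R => (normal_lr s t x)%:E).
  by apply/measurable_EFinP; exact: measurable_normal_lr.
have lr0 x : (0 <= (normal_lr s t x)%:E)%E.
  by rewrite lee_fin mulr_ge0 ?expR_ge0// invr_ge0 ltW.
have pdf0 x : (0 <= (normal_pdf (0 : R) 1 x)%:E)%E by rewrite lee_fin normal_pdf_ge0.
rewrite !ge0_integral_normal_prob//; first last.
- exact: measurableT_comp.
- by move=> x; rewrite mule_ge0.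
- exact: emeasurable_funM.
(* Only the right side is substituted, so that [f] has the argument t + s x on both sides; the
   Jacobian s cancels the factor 1/s of [normal_lr]. *)
rewrite [RHS](ge0_integral_affine t s0); first last.
- by move=> x; rewrite !mule_ge0.
- by do 2 apply: emeasurable_funM => //.
rewrite -ge0_integralZl//; first last.
- by rewrite lee_fin ltW.
- by move=> x _; rewrite !mule_ge0.
- pose h x := (f x * (normal_lr s t x)%:E * (normal_pdf 0 1 x)%:E)%E.
  by apply: (measurableT_comp (f := h)) => //; do 2 apply: emeasurable_funM => //.
apply: eq_integral => x _; rewrite -[in RHS]muleA [RHS]muleCA; congr (_ * _)%E.
rewrite -!EFinM; congr EFin.
rewrite !normal_pdf01E /normal_lr.
set P := normal_peak 1; set E1 := expR (_ - _); set E2 := expR (- (t + _) ^+ 2 / _).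
have -> : s * (s^-1 * E1 * (P * E2)) = P * (E1 * E2) by field; rewrite gt_eqF.
rewrite -expRD; congr (_ * expR _).
by field; rewrite gt_eqF.
Qed.

End gaussian.

(** * I.i.d. samples *)

Lemma measurable_cons_tuple {d} {T : measurableType d} n :
  measurable_fun setT (@Defs.cons_tuple _ T n).
Proof. exact: measurable_cons. Qed.

Section iid_integral.
Context {d} {T : measurableType d} {R : realType} (P : probability T R).

Lemma ge0_integral_iidS n (f : n.+1.-tuple T -> \bar R) :
  measurable_fun setT f -> (forall t, 0 <= f t)%E ->
  (\int[iid P n.+1]_t f t = \int[P]_x \int[iid P n]_t f (Defs.cons_tuple (x, t)))%E.
Proof.
move=> mf f0; rewrite ge0_integral_distribution//.
rewrite fubini_tonelli1//; last by move=> x; exact: f0.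
by apply: measurableT_comp => //; exact: measurable_cons_tuple.
Qed.

Lemma integral_iid0 (f : 0.-tuple T -> \bar R) :
  measurable_fun setT f -> (\int[iid P 0]_t f t = f [tuple])%E.
Proof. by move=> mf; rewrite integral_dirac// diracT mul1e. Qed.

Lemma measurable_prod_tnth n (h : 'I_n -> T -> R) :
  (forall i, measurable_fun setT (h i)) ->
  measurable_fun setT (fun t : n.-tuple T => \prod_(i < n) h i (tnth t i)).
Proof.
move=> mh; apply: measurable_prod => i _.
by apply: measurableT_comp => //; exact: measurable_tnth.
Qed.

Lemma integral_iid_prod n (h : 'I_n -> T -> R) (c : 'I_n -> R) :
  (forall i, measurable_fun setT (h i)) -> (forall i x, 0 <= h i x) ->
  (forall i, \int[P]_x (h i x)%:E = (c i)%:E)%E ->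
  (\int[iid P n]_t (\prod_(i < n) h i (tnth t i))%:E = (\prod_(i < n) c i)%:E)%E.
Proof.
elim: n h c => [|n IH] h c mh h0 hc.
  rewrite integral_iid0 ?big_ord0//.
  by apply/measurable_EFinP; exact: measurable_prod_tnth.
rewrite ge0_integral_iidS; last 2 first.
- by apply/measurable_EFinP; exact: measurable_prod_tnth.
- by move=> t; rewrite lee_fin prodr_ge0.
transitivity (\int[P]_x ((h ord0 x)%:E * (\prod_(i < n) c (lift ord0 i))%:E))%E.
  apply: eq_integral => x _.
  rewrite -(IH (fun i => h (lift ord0 i)))//.
  rewrite -ge0_integralZl//.
  - apply: eq_integral => t _; rewrite -EFinM big_ord_recl; congr (_ * _)%:E.
    by apply: eq_bigr => i _; rewrite tnthS.
  - by apply/measurable_EFinP; exact: (measurable_prod_tnth (h := fun i => h (lift ord0 i))).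
  - by move=> t _; rewrite lee_fin prodr_ge0.
  - by rewrite lee_fin.
rewrite ge0_integralZr//; first by rewrite hc -EFinM big_ord_recl.
- exact/measurable_EFinP.
- by move=> x _; rewrite lee_fin.
- rewrite lee_fin prodr_ge0// => i _.
  by rewrite -lee_fin -hc integral_ge0// => x _; rewrite lee_fin.
Qed.

End iid_integral.

Section gaussian_vectors.
Context {R : realType}.
Local Notation G := (normal_prob (0 : R) 1).

Definition affine_tuple n (t : 'I_n -> R) (s : R) (g : n.-tuple (measurableTypeR R)) :
  n.-tuple (measurableTypeR R) := [tuple t i + s * tnth g i | i < n].

Lemma measurable_affine_tuple n (t : 'I_n -> R) (s : R) :
  measurable_fun setT (affine_tuple t s).
Proof.
apply/measurable_fun_tnthP => i; rewrite /affine_tuple.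
rewrite (_ : _ \o _ = fun g : n.-tuple (measurableTypeR R) => t i + s * tnth g i); last first.
  by apply/funext => g; rewrite /= tnth_mktuple.
apply: measurable_funD => //; apply: measurable_funM => //.
exact: measurable_tnth.
Qed.

(** Girsanov-type formula in n dimensions: by independence the density of the shifted and rescaled
    sample is the product of the coordinate densities. *)
Lemma integral_iid_normal_lr n (t : 'I_n -> R) (s : R)
    (f : n.-tuple (measurableTypeR R) -> \bar R) :
  0 < s -> measurable_fun setT f -> (forall x, 0 <= f x)%E ->
  (\int[iid G n]_g f (affine_tuple t s g) =
   \int[iid G n]_g (f g * (\prod_(i < n) normal_lr s (t i) (tnth g i))%:E))%E.
Proof.
move=> s0; have lr0 a x : 0 <= normal_lr s a x.
  by rewrite mulr_ge0 ?expR_ge0// invr_ge0 ltW.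
have mprod n' (t' : 'I_n' -> R) :
    measurable_fun setT (fun g : n'.-tuple (measurableTypeR R) =>
      (\prod_(i < n') normal_lr s (t' i) (tnth g i))%:E).
  apply/measurable_EFinP; apply: (measurable_prod_tnth (h := fun i x => normal_lr s (t' i) x)).
  by move=> i; exact: measurable_normal_lr.
elim: n t f => [|n IH] t f mf f0.
  rewrite !integral_iid0//.
  - by rewrite big_ord0 mule1; congr f; exact: tuple0.
  - by apply: emeasurable_funM => //; exact: mprod.
  - by apply: measurableT_comp => //; exact: measurable_affine_tuple.
rewrite !ge0_integral_iidS//; first last.
- by apply: measurableT_comp => //; exact: measurable_affine_tuple.
- by move=> g; rewrite mule_ge0// lee_fin prodr_ge0.
- by apply: emeasurable_funM => //; exact: mprod.
pose t' i := t (lift ord0 i).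
pose F (w : measurableTypeR R * n.-tuple (measurableTypeR R)) :=
  (f (Defs.cons_tuple w) * (\prod_(i < n) normal_lr s (t' i) (tnth w.2 i))%:E)%E.
have mF : measurable_fun setT F.
  apply: emeasurable_funM.
    by apply: measurableT_comp => //; exact: measurable_cons_tuple.
  exact: (measurableT_comp (mprod _ t') measurable_snd).
have F0 w : (0 <= F w)%E by rewrite mule_ge0// lee_fin prodr_ge0.
(* [H] integrates out the tail after the induction hypothesis has moved its shifts into the density;
   the one-dimensional formula then handles the first coordinate. *)
pose H x := (\int[iid G n]_g F (x, g))%E.
transitivity (\int[G]_x H (t ord0 + s * x)%R)%E.
  apply: eq_integral => x _; rewrite /H /F /=.
  rewrite -(IH t' (fun g => f (Defs.cons_tuple (t ord0 + s * x, g))))//.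
    apply: eq_integral => g _; congr f; apply: eq_from_tnth => i.
    rewrite tnth_mktuple; case: (unliftP ord0 i) => [j ->|->] //=.
    by rewrite /Defs.cons_tuple !tnthS tnth_mktuple.
  apply: (measurableT_comp mf).
  exact: (measurableT_comp (@measurable_cons_tuple _ _ n) (pair1_measurable _)).
rewrite integral_normal_lr//.
- apply: eq_integral => x _; rewrite /H -ge0_integralZr//; last 2 first.
  + exact: (measurableT_comp mF (pair1_measurable _)).
  + by rewrite lee_fin.
  apply: eq_integral => g _; rewrite /F/= -muleA -EFinM; congr (_ * _%:E)%E.
  rewrite big_ord_recl mulrC; congr (_ * _).
  by apply: eq_bigr => i _; rewrite tnthS.
- exact: measurable_fun_fubini_tonelli_F.
- by move=> x; apply: integral_ge0.
Qed.

End gaussian_vectors.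

(** * Bivariate normal densities and Gaussian vectors *)

(* 2 pi times the density at (z1, z2) of the centred bivariate normal law with
   covariance [[V1, K], [K, V2]]. *)
Definition binormal {R : realType} (V1 V2 K z1 z2 : R) : R :=
  (Num.sqrt (V1 * V2 - K ^+ 2))^-1 *
  expR (- (V2 * z1 ^+ 2 - 2 * K * z1 * z2 + V1 * z2 ^+ 2) / (2 * (V1 * V2 - K ^+ 2))).

Section binormal.
Context {R : realType}.
Local Notation G := (normal_prob (0 : R) 1).

(** Adding the rank-one matrix of the vector (a, b) keeps a 2 x 2 covariance positive definite;
    after multiplication by [V1] the determinant is visibly a sum of nonnegative terms, the first of
    them positive. *)
Lemma cov_det_gt0 (V1 V2 K a b : R) : 0 < V1 -> 0 < V1 * V2 - K ^+ 2 ->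
  0 < (V1 + a ^+ 2) * (V2 + b ^+ 2) - (K + a * b) ^+ 2.
Proof.
move=> V10 D0; rewrite -(pmulr_rgt0 _ V10).
have -> : V1 * ((V1 + a ^+ 2) * (V2 + b ^+ 2) - (K + a * b) ^+ 2) =
  V1 * (V1 * V2 - K ^+ 2) + ((b * V1 - a * K) ^+ 2 + a ^+ 2 * (V1 * V2 - K ^+ 2)) by ring.
by rewrite ltr_pwDl ?mulr_gt0// addr_ge0 ?sqr_ge0// mulr_ge0 ?sqr_ge0// ltW.
Qed.

Lemma cov_det_sum_gt0 n (V1 V2 K : R) (a b : 'I_n -> R) :
  0 < V1 -> 0 < V1 * V2 - K ^+ 2 ->
  0 < (V1 + \sum_(i < n) a i ^+ 2) * (V2 + \sum_(i < n) b i ^+ 2) -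
      (K + \sum_(i < n) a i * b i) ^+ 2.
Proof.
elim: n V1 V2 K a b => [|n IH] V1 V2 K a b V10 D0; first by rewrite !big_ord0 !addr0.
rewrite !big_ord_recl !addrA; apply: IH; last exact: cov_det_gt0.
by rewrite ltr_wpDr ?sqr_ge0.
Qed.

Lemma measurable_binormal d (T : measurableType d) (V1 V2 K : R) (f g : T -> R) :
  measurable_fun setT f -> measurable_fun setT g ->
  measurable_fun setT (fun x => binormal V1 V2 K (f x) (g x)).
Proof.
move=> mf mg; apply: measurable_funM => //; apply: measurableT_comp => //.
apply: measurable_funM => //; apply: measurable_funN.
have mf2 : measurable_fun setT (fun x => f x ^+ 2) by exact: measurable_funX.
have mg2 : measurable_fun setT (fun x => g x ^+ 2) by exact: measurable_funX.
by apply: measurable_funD; [apply: measurable_funB|]; do ?apply: measurable_funM.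
Qed.

Lemma binormal_ge0 (V1 V2 K z1 z2 : R) : 0 <= binormal V1 V2 K z1 z2.
Proof. by rewrite mulr_ge0 ?expR_ge0// invr_ge0 sqrtr_ge0. Qed.

(** Convolution: adding an independent x (a, b), with x standard normal, adds a rank-one term to the
    covariance. The exponent is quadratic in x with coefficients [A], [B], [C]. *)
Lemma integral_binormal1 (V1 V2 K z1 z2 a b : R) :
  0 < V1 -> 0 < V1 * V2 - K ^+ 2 ->
  (\int[G]_x (binormal V1 V2 K (z1 - a * x) (z2 - b * x))%:E =
   (binormal (V1 + a ^+ 2) (V2 + b ^+ 2) (K + a * b) z1 z2)%:E)%E.
Proof.
move=> V10 D0; have D'0 := cov_det_gt0 a b V10 D0.
rewrite /binormal.
set D' := (V1 + _) * _ - _ in D'0 *; set D := V1 * V2 - _ in D0 *.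
pose A := (a ^+ 2 * V2 - 2 * a * b * K + b ^+ 2 * V1) / D.
pose B := (a * V2 * z1 - K * (a * z2 + b * z1) + b * V1 * z2) / D.
pose C := (V2 * z1 ^+ 2 - 2 * K * z1 * z2 + V1 * z2 ^+ 2) / D.
(* Matrix determinant lemma for the rank-one update; this ratio turns the normalization of the old
   covariance into that of the new one. *)
have A1 : 1 + A = D' / D by rewrite /A /D' /D; field; rewrite gt_eqF.
transitivity (\int[G]_x ((Num.sqrt D)^-1%:E * (expR (- (A * x ^+ 2 - 2 * B * x + C) / 2))%:E))%E.
  apply: eq_integral => x _; rewrite -EFinM; congr (_ * expR _)%:E.
  by rewrite /A /B /C /D; field; rewrite gt_eqF.
rewrite ge0_integralZl//; last first.
- exact: measurable_expR_quad.
rewrite integral_normal_expR_quad A1 ?divr_gt0// -EFinM mulrA; congr (_ * expR _)%:E.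
  by rewrite -invfM -sqrtrM ?ltW// mulrCA mulfV ?mulr1// gt_eqF.
rewrite /B /C /D' /D; field.
by rewrite !gt_eqF// mulf_neq0// gt_eqF.
Qed.

Lemma integral_binormal n (V1 V2 K z1 z2 : R) (a b : 'I_n -> R) :
  0 < V1 -> 0 < V1 * V2 - K ^+ 2 ->
  (\int[iid G n]_t (binormal V1 V2 K (z1 - \sum_(i < n) a i * tnth t i)
                                     (z2 - \sum_(i < n) b i * tnth t i))%:E =
   (binormal (V1 + \sum_(i < n) a i ^+ 2) (V2 + \sum_(i < n) b i ^+ 2)
             (K + \sum_(i < n) a i * b i) z1 z2)%:E)%E.
Proof.
have mlin m (c : 'I_m -> R) z : measurable_fun setT
    (fun t : m.-tuple (measurableTypeR R) => z - \sum_(i < m) c i * tnth t i).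
  apply: measurable_funB => //; apply: measurable_sum => i.
  by apply: measurable_funM => //; exact: measurable_tnth.
elim: n V1 V2 K z1 z2 a b => [|n IH] V1 V2 K z1 z2 a b V10 D0.
  rewrite integral_iid0; first by rewrite !big_ord0 !subr0 !addr0.
  by apply/measurable_EFinP; apply: measurable_binormal; exact: mlin.
rewrite ge0_integral_iidS; last 2 first.
- by apply/measurable_EFinP; apply: measurable_binormal; exact: mlin.
- by move=> t; rewrite lee_fin binormal_ge0.
pose a' i := a (lift ord0 i); pose b' i := b (lift ord0 i).
transitivity (\int[G]_x (binormal (V1 + \sum_(i < n) a' i ^+ 2) (V2 + \sum_(i < n) b' i ^+ 2)
             (K + \sum_(i < n) a' i * b' i) (z1 - a ord0 * x) (z2 - b ord0 * x))%:E)%E.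
  apply: eq_integral => x _; rewrite -(IH _ _ _ _ _ a' b' V10 D0).
  apply: eq_integral => t _.
  have sE (c : 'I_n.+1 -> R) z : z - \sum_(i < n.+1) c i * tnth (Defs.cons_tuple (x, t)) i =
      z - c ord0 * x - \sum_(i < n) c (lift ord0 i) * tnth t i.
    rewrite big_ord_recl opprD addrA; congr (_ - _).
    by apply: eq_bigr => i _; rewrite tnthS.
  by rewrite !sE.
rewrite integral_binormal1.
- by rewrite !big_ord_recl -!addrA !(addrC (\sum_(i < n) _)).
- by rewrite ltr_wpDr// sumr_ge0// => i _; rewrite sqr_ge0.
- exact: cov_det_sum_gt0.
Qed.

End binormal.

Section mvnormal.
Context {R : realType}.
Local Notation G := (normal_prob (0 : R) 1).

Lemma cV_sqr_le0 p (w : 'cV[R]_p) : (w^T *m w) 0 0 <= 0 -> w = 0.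
Proof.
rewrite mxE => w0; apply/matrixP => i j; rewrite [j]ord1 mxE.
have h : \sum_(i < p) w i 0 ^+ 2 = 0.
  apply/eqP; rewrite eq_le sumr_ge0 ?andbT// => [|k _]; last by rewrite sqr_ge0.
  by rewrite (le_trans _ w0)//; apply: ler_sum => k _; rewrite !mxE.
have := psumr_eq0P (fun k _ => sqr_ge0 (w k 0)) h.
by move/(_ i isT)/eqP; rewrite sqrf_eq0 => /eqP.
Qed.

(** [psd_sqrt] is a choice, so uniqueness is needed. If S is another root, then M = S - s I
    satisfies S M = - s M, and a nonzero column of M would be an eigenvector of S for the eigenvalue
    -s < 0. *)
Lemma psd_sqrt_scalar p (s : R) : 0 < s -> psd_sqrt ((s ^+ 2)%:M : 'M[R]_p) = s%:M.
Proof.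
move=> s0; apply: xget_unique => [|S [ST S0 SS]].
  split; first by rewrite tr_scalar_mx.
    move=> u; rewrite mul_mx_scalar -scalemxAl mxE; apply: mulr_ge0; first exact: ltW.
    by rewrite mxE; apply: sumr_ge0 => i _; rewrite mxE -expr2 sqr_ge0.
  by rewrite -scalar_mxM expr2.
apply/eqP; rewrite -subr_eq0; apply/eqP.
set M := S - s%:M; suff colM j : col j M = 0.
  by apply/matrixP => i j; have /matrixP/(_ i 0) := colM j; rewrite !mxE.
apply: cV_sqr_le0; set w := col j M.
have Sw : S *m w = - (s *: w).
  have SM : S *m M = - (s *: M).
    rewrite mulmxBr SS mul_mx_scalar scalerBr scale_scalar_mx expr2.
    by rewrite opprB.
  by rewrite /w colE mulmxA SM mulNmx scalemxAl.
have := S0 w; rewrite -mulmxA Sw mulmxN -scalemxAr !mxE.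
by rewrite oppr_ge0 pmulr_rle0.
Qed.

Lemma ge0_integral_mvnormal_scalar p (s : R) (f : 'cV[R]_p -> \bar R) :
  0 < s -> measurable_fun setT f -> (forall x, 0 <= f x)%E ->
  (\int[mvnormal ((s ^+ 2)%:M)]_x f x =
   \int[iid G p]_g f (s *: \col_i (tnth g i : R)))%E.
Proof.
move=> s0 mf f0; rewrite ge0_integral_distribution//.
apply: eq_integral => g _ /=.
by rewrite /tuple_lmap psd_sqrt_scalar// mul_scalar_mx.
Qed.

Definition dotc p (x d : 'cV[R]_p) : R := \sum_(j < p) x j 0 * d j 0.

Lemma measurable_dotc p (d : 'cV[R]_p) : measurable_fun setT (fun x => dotc x d).
Proof.
apply: measurable_sum => j; apply: measurable_funM => //.
exact: measurable_entry.
Qed.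

Lemma normal_lr_ge0 (s t z : R) : 0 < s -> 0 <= normal_lr s t z.
Proof. by move=> s0; rewrite mulr_ge0 ?expR_ge0// invr_ge0 ltW. Qed.

(** This is the determinant of s^2 I plus the Gram matrix of d and d', whose diagonal entries are
    both 1. *)
Lemma dotc_sqr_lt1 p (d d' : 'cV[R]_p) (s : R) : 0 < s ->
  s ^+ 2 + dotc d d = 1 -> s ^+ 2 + dotc d' d' = 1 ->
  0 < 1 - dotc d d' ^+ 2.
Proof.
move=> s0 hd hd'.
have /= := @cov_det_sum_gt0 R p (s ^+ 2) (s ^+ 2) 0 (fun j => d j 0) (fun j => d' j 0).
rewrite expr0n/= subr0 add0r; move/(_ (exprn_gt0 _ s0) (mulr_gt0 (exprn_gt0 _ s0) (exprn_gt0 _ s0))).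
by rewrite hd hd' mulr1.
Qed.

(** Second moment for one observation. Integrating over the row first, at fixed noise g, gives a
    bivariate normal density with unit variances and correlation k at (g, g); the remaining integral
    over g is one-dimensional. *)
Lemma integral_row_lr p (d d' : 'cV[R]_p) (s : R) : 0 < s ->
  s ^+ 2 + dotc d d = 1 -> s ^+ 2 + dotc d' d' = 1 ->
  (\int[mvnormal (1%:M : 'M[R]_p)]_x \int[G]_g
     (normal_lr s (dotc x d) g * normal_lr s (dotc x d') g)%:E =
   ((1 - dotc d d')^-1)%:E)%E.
Proof.
move=> s0 hd hd'; have k1 := dotc_sqr_lt1 s0 hd hd'.
set k := dotc d d' in k1 *.
have k2 : 0 < (1 - k) * (1 + k) by rewrite -subr_sqr expr1n.
have [k3 k4] : 0 < 1 - k /\ 0 < 1 + k by nra.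
pose f (w : 'cV[R]_p * measurableTypeR R) :=
  (normal_lr s (dotc w.1 d) w.2 * normal_lr s (dotc w.1 d') w.2)%:E.
have mf : measurable_fun setT f.
  apply/measurable_EFinP; apply: measurable_funM; apply: measurable_fun_normal_lr => //.
    exact: (measurableT_comp (measurable_dotc d) measurable_fst).
  exact: (measurableT_comp (measurable_dotc d') measurable_fst).
have f0 w : (0 <= f w)%E by rewrite lee_fin mulr_ge0// normal_lr_ge0.
rewrite -[LHS]/(\int[mvnormal 1%:M]_x \int[G]_g f (x, g))%E fubini_tonelli//.
transitivity (\int[G]_g ((Num.sqrt (1 - k ^+ 2))^-1%:E *
    (expR (- ((2 / (1 + k) - 2) * g ^+ 2 - 2 * 0 * g + 0) / 2))%:E))%E.
  apply: eq_integral => g _.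
  have -> : (1%:M : 'M[R]_p) = (1 ^+ 2)%:M by rewrite expr1n.
  rewrite ge0_integral_mvnormal_scalar//; last exact: (measurableT_comp mf (pair2_measurable _)).
  (* Each likelihood ratio divides by the standard normal density at g; the two together contribute
     exp (g^2), up to the 2 pi that [binormal] leaves out. *)
  transitivity (\int[iid G p]_t ((expR (g ^+ 2))%:E *
    (binormal (s ^+ 2) (s ^+ 2) 0 (g - \sum_(i < p) d i 0 * tnth t i)
     (g - \sum_(i < p) d' i 0 * tnth t i))%:E))%E.
    apply: eq_integral => t _; rewrite /f/= -EFinM; congr EFin.
    have dE e : dotc (1 *: \col_i (tnth t i : R)) e = \sum_(i < p) e i 0 * tnth t i.
      by apply: eq_bigr => i _; rewrite !mxE mul1r mulrC.
    rewrite !dE /binormal /normal_lr; set u := \sum_(i < p) _; set v := \sum_(i < p) _.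
    rewrite expr0n/= subr0 sqrtrM ?sqr_ge0// !sqrtr_sqr !gtr0_norm//.
    rewrite mulrACA -invfM -expRD [RHS]mulrCA -expRD; congr (_ * expR _).
    by field; rewrite gt_eqF.
  rewrite ge0_integralZl//; last first.
  - by move=> t _; rewrite lee_fin binormal_ge0.
  - apply/measurable_EFinP; apply: measurable_binormal; apply: measurable_funB => //;
    apply: measurable_sum => i; apply: measurable_funM => //; exact: measurable_tnth.
  rewrite integral_binormal ?exprn_gt0//; last by rewrite expr0n subr0 mulr_gt0 ?exprn_gt0.
  have -> : s ^+ 2 + \sum_(i < p) d i 0 ^+ 2 = 1 by exact: hd.
  have -> : s ^+ 2 + \sum_(i < p) d' i 0 ^+ 2 = 1 by exact: hd'.
  have -> : 0 + \sum_(i < p) d i 0 * d' i 0 = k by rewrite add0r.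
  rewrite -!EFinM /binormal mulr1 mulrCA -expRD; congr (_ * expR _)%:E.
  by field; rewrite !gt_eqF.
rewrite ge0_integralZl//; last first.
- exact: measurable_expR_quad.
have E1 : 1 + (2 / (1 + k) - 2) = (1 - k) / (1 + k) by field; rewrite gt_eqF.
rewrite integral_normal_expR_quad; last by rewrite E1 divr_gt0.
rewrite E1 expr0n/= mul0r subr0 mul0r expR0 mulr1 -EFinM -invfM -sqrtrM ?(ltW k1)//.
have -> : (1 - k ^+ 2) * ((1 - k) / (1 + k)) = (1 - k) ^+ 2 by field; rewrite gt_eqF.
by rewrite sqrtr_sqr gtr0_norm.
Qed.

End mvnormal.

(** * Mixtures *)

Section mixture.
Context {d} {T : measurableType d} {R : realType} (nu : probability T R).

Lemma integral_sum_EFin (I : eqType) (s : seq I) (F : I -> T -> R) (c : I -> R) :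
  (forall i, measurable_fun setT (F i)) -> (forall i x, 0 <= F i x) ->
  (forall i, i \in s -> \int[nu]_x (F i x)%:E = (c i)%:E)%E ->
  (\int[nu]_x (\sum_(i <- s) F i x)%:E = (\sum_(i <- s) c i)%:E)%E.
Proof.
move=> mF F0 Fc; under eq_integral do rewrite -sumEFin.
rewrite ge0_integral_sum//.
- by rewrite -sumEFin; apply: eq_big_seq => i /Fc.
- by move=> i; exact/measurable_EFinP.
- by move=> i x _; rewrite lee_fin.
Qed.

(* [|1 - g| <= t / 2 + (1 - g)^2 / (2 t)] for the mixture density [g], so that a
   small chi-square divergence [eta] transfers bounds from the mixture to [nu]. *)
Lemma le_mixture (I : eqType) (s : seq I) (L : I -> T -> R) (c : I -> I -> R)
    (A : set T) (delta eta t : R) :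
  (0 < size s)%N -> 0 < t ->
  (forall i, measurable_fun setT (L i)) -> (forall i x, 0 <= L i x) ->
  (forall i, i \in s -> \int[nu]_x (L i x)%:E = 1)%E ->
  (forall i j, i \in s -> j \in s -> \int[nu]_x (L i x * L j x)%:E = (c i j)%:E)%E ->
  \sum_(i <- s) \sum_(j <- s) c i j <= (size s)%:R ^+ 2 * (1 + eta) ->
  measurable A ->
  (forall i, i \in s -> \int[nu]_x (\1_A x * L i x)%:E <= delta%:E)%E ->
  (nu A <= (delta + t / 2 + eta / (2 * t))%:E)%E.
Proof.
move=> s0 t0 mL L0 L1 Lc hc mA hA; set N : R := (size s)%:R.
have N0 : 0 < N by rewrite ltr0n.
have sumN (x : R) : \sum_(i <- s) x = N * x.
  by rewrite big_const_seq count_predT iter_addr_0 mulr_natl.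
pose S1 x := \sum_(i <- s) L i x.
pose SA x := \sum_(i <- s) \1_A x * L i x.
pose S2 x := \sum_(i <- s) \sum_(j <- s) L i x * L j x.
have mA1 : measurable_fun setT (\1_A : T -> R) by exact: measurable_indic.
have mAL i : measurable_fun setT (fun x => \1_A x * L i x) by exact: measurable_funM.
have mLL i j : measurable_fun setT (fun x => L i x * L j x) by exact: measurable_funM.
have A0 x : 0 <= \1_A x :> R by rewrite indicE ler0n.
have mS1 : measurable_fun setT S1 by exact: measurable_sum.
have mSA : measurable_fun setT SA by exact: measurable_sum.
have mS2 : measurable_fun setT S2.
  by apply: measurable_sum => i; exact: measurable_sum.
have S10 x : 0 <= S1 x by exact: sumr_ge0.
have SA0 x : 0 <= SA x by apply: sumr_ge0 => i _; exact: mulr_ge0.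
have S20 x : 0 <= S2 x.
  by apply: sumr_ge0 => i _; apply: sumr_ge0 => j _; exact: mulr_ge0.
have I1 : (\int[nu]_x (S1 x)%:E = N%:E)%E.
  by rewrite (integral_sum_EFin (c := fun=> 1))// sumN mulr1.
pose a i := fine (\int[nu]_x (\1_A x * L i x)%:E)%E.
have aE i : i \in s -> (\int[nu]_x (\1_A x * L i x)%:E = (a i)%:E)%E.
  move=> si; rewrite fineK// ge0_fin_numE ?(le_lt_trans (hA _ si)) ?ltry//.
  by apply: integral_ge0 => x _; rewrite lee_fin mulr_ge0.
have IA : (\int[nu]_x (SA x)%:E = (\sum_(i <- s) a i)%:E)%E.
  by apply: integral_sum_EFin => // i x; rewrite mulr_ge0.
have I2 : (\int[nu]_x (S2 x)%:E = (\sum_(i <- s) \sum_(j <- s) c i j)%:E)%E.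
  apply: integral_sum_EFin => [i|i x|i si].
  - exact: measurable_sum.
  - by apply: sumr_ge0 => j _; exact: mulr_ge0.
  - apply: integral_sum_EFin => // [j x|j sj]; first exact: mulr_ge0.
    exact: Lc.
have sa : \sum_(i <- s) a i <= N * delta.
  rewrite -sumN big_seq [leRHS]big_seq; apply: ler_sum => i si.
  by rewrite -lee_fin -aE// hA.
(* With g = S1 / N this is 1_A <= 1_A g + t / 2 + (1 - g)^2 / (2 t), where the square is expanded
   and its negative term - g / t moved to the left, so that only nonnegative functions are
   integrated. *)
have pt x : \1_A x + (t * N)^-1 * S1 x <= N^-1 * SA x + (t / 2 + (2 * t)^-1) +
    (2 * t * N ^+ 2)^-1 * S2 x.
  have -> : S2 x = S1 x ^+ 2.
    by rewrite expr2 mulr_suml; apply: eq_bigr => i _; rewrite mulr_sumr.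
  have -> : SA x = \1_A x * S1 x by rewrite mulr_sumr.
  rewrite -subr_ge0.
  set y := S1 x; pose g := y / N; set e : R := \1_A x.
  have -> : y = g * N by rewrite /g divfK// gt_eqF.
  have -> : N^-1 * (e * (g * N)) + (t / 2 + (2 * t)^-1) + (2 * t * N ^+ 2)^-1 * (g * N) ^+ 2 -
      (e + (t * N)^-1 * (g * N)) = (2 * t)^-1 * (t ^+ 2 + (1 - g) ^+ 2 - e * (2 * t * (1 - g))).
    by field; rewrite !gt_eqF.
  apply: mulr_ge0; first by rewrite invr_ge0 mulr_ge0 ?ltW.
  have [->|->] : e = 0 \/ e = 1.
    by rewrite /e indicE; case: (_ \in _); [right|left].
  - by rewrite mul0r subr0 addr_ge0 ?sqr_ge0.
  - rewrite (_ : _ - _ = (t - (1 - g)) ^+ 2); last by ring.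
    exact: sqr_ge0.
have le : (\int[nu]_x ((\1_A x)%:E + (t * N)^-1%:E * (S1 x)%:E) <=
  \int[nu]_x ((N^-1%:E * (SA x)%:E + (t / 2 + (2 * t)^-1)%:E) +
    (2 * t * N ^+ 2)^-1%:E * (S2 x)%:E))%E.
  apply: ge0_le_integral => //.
  - by move=> x _; rewrite -EFinM -EFinD lee_fin addr_ge0// mulr_ge0// invr_ge0 mulr_ge0 ?ltW.
  - by apply: emeasurable_funD; [|apply: emeasurable_funM => //]; exact/measurable_EFinP.
  - apply: emeasurable_funD; [apply: emeasurable_funD => //|];
    by apply: emeasurable_funM => //; exact/measurable_EFinP.
  - by move=> x _; rewrite -!EFinM -!EFinD lee_fin.
have tN0 : 0 <= (t * N)^-1 by rewrite invr_ge0 mulr_ge0 ?ltW.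
have t20 : 0 <= t / 2 + (2 * t)^-1.
  by rewrite addr_ge0 ?invr_ge0 ?mulr_ge0 ?ltW// invr_gt0.
have tN2 : 0 <= (2 * t * N ^+ 2)^-1 by rewrite invr_ge0 !mulr_ge0 ?ltW.
have N10 : 0 <= N^-1 by rewrite invr_ge0 ltW.
have eS1 : measurable_fun setT (EFin \o S1) by exact/measurable_EFinP.
have eSA : measurable_fun setT (EFin \o SA) by exact/measurable_EFinP.
have eS2 : measurable_fun setT (EFin \o S2) by exact/measurable_EFinP.
have eA : measurable_fun setT (EFin \o (\1_A : T -> R)) by exact/measurable_EFinP.
move: le; rewrite ge0_integralD//; last 2 first.
- by move=> x _; rewrite mule_ge0// lee_fin.
- exact: emeasurable_funM.
rewrite ge0_integralZl//; last by move=> x _; rewrite lee_fin.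
rewrite I1 integral_indic// setIT.
rewrite ge0_integralD//; last 4 first.
- by move=> x _; rewrite adde_ge0 ?mule_ge0 ?lee_fin.
- by apply: emeasurable_funD => //; exact: emeasurable_funM.
- by move=> x _; rewrite mule_ge0 ?lee_fin.
- exact: emeasurable_funM.
rewrite ge0_integralD//; last 2 first.
- by move=> x _; rewrite mule_ge0 ?lee_fin.
- exact: emeasurable_funM.
rewrite !ge0_integralZl ?lee_fin//; last 2 first.
- by move=> x _; rewrite lee_fin.
- by move=> x _; rewrite lee_fin.
have IC (r : R) : (\int[nu]_x r%:E = r%:E)%E.
  by rewrite integral_cst// -[RHS]mule1; congr (_ * _)%E; exact: probability_setT.
rewrite IA I2 IC.
have nuA : nu A \is a fin_num by exact: fin_num_measure.
rewrite -!EFinM -!EFinD => le.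
have {}le : ((fine (nu A))%:E + ((t * N)^-1 * N)%:E <=
     (N^-1 * \sum_(i <- s) a i + (t / 2 + (2 * t)^-1) +
      (2 * t * N ^+ 2)^-1 * \sum_(i <- s) \sum_(j <- s) c i j)%:E)%E by rewrite fineK.
rewrite -EFinD lee_fin in le; rewrite -(fineK nuA) lee_fin.
have h1 : N^-1 * \sum_(i <- s) a i <= delta.
  by rewrite mulrC ler_pdivrMr// mulrC.
have h2 : (2 * t * N ^+ 2)^-1 * \sum_(i <- s) \sum_(j <- s) c i j <= (1 + eta) / (2 * t).
  rewrite invfM -mulrA [leRHS]mulrC; apply: ler_wpM2l.
    by rewrite invr_ge0 mulr_ge0 ?ltW.
  by rewrite mulrC ler_pdivrMr ?exprn_gt0// mulrC.
have e1 : (t * N)^-1 * N = t^-1 by field; rewrite !gt_eqF.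
have e2 : (1 + eta) / (2 * t) = t^-1 - (2 * t)^-1 + eta / (2 * t) by field; rewrite gt_eqF.
by move: le h2; rewrite e1 e2; lra.
Qed.

End mixture.

(** * Likelihood ratios of the linear model *)

Section likelihood.
Context {R : realType}.
Local Notation G := (normal_prob (0 : R) 1).
Variables n p : nat.
Local Notation noise := (n.-tuple (measurableTypeR R)).
Local Notation design := (n.-tuple 'cV[R]_p).

(* The law of the design and of the normalized noise is the same under every
   parameter with identity covariance. *)
Definition ref_law : probability (design * noise)%type R :=
  (iid (mvnormal (1%:M : 'M[R]_p)) n \x iid G n)%E.

Definition observe (b : 'cV[R]_p) (s : R) (w : design * noise) : 'M[R]_(n, p) * 'cV[R]_n :=
  regression b (w.1, s *: \col_i (tnth w.2 i : R)).

Lemma measurable_observe b s : measurable_fun setT (observe b s).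
Proof.
apply: (measurableT_comp (f := regression b)) => //.
apply: measurable_fun_pair => //; apply/measurable_matrixP => i j.
under eq_fun do rewrite !mxE.
apply: measurable_funM => //.
exact: (measurableT_comp (measurable_tnth i) measurable_snd).
Qed.

Lemma ge0_integral_model b (s : R) (f : 'M[R]_(n, p) * 'cV[R]_n -> \bar R) :
  0 < s -> measurable_fun setT f -> (forall z, 0 <= f z)%E ->
  (\int[model n (Param b 1%:M s)]_z f z =
   \int[iid (mvnormal (1%:M : 'M[R]_p)) n]_X \int[iid G n]_g f (observe b s (X, g)))%E.
Proof.
move=> s0 mf f0; rewrite ge0_integral_distribution//.
have mfr : measurable_fun setT (f \o regression (n := n) b).
  exact: measurableT_comp.
rewrite fubini_tonelli1//; last by move=> w; exact: f0.
apply: eq_integral => X _; rewrite /fubini_F ge0_integral_mvnormal_scalar//.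
- exact: (measurableT_comp mfr (pair1_measurable _)).
- by move=> e; exact: f0.
Qed.

(** Likelihood ratio of (b + s0 d, s0 s) against (b, s0), in terms of the design and the null's
    normalized residual. In these coordinates neither b nor s0 occurs. *)
Definition likelihood (s : R) (d : 'cV[R]_p) (w : design * noise) : R :=
  \prod_(i < n) normal_lr s (dotc (tnth w.1 i) d) (tnth w.2 i).

Lemma likelihood_ge0 s d w : 0 < s -> 0 <= likelihood s d w.
Proof. by move=> s0; apply: prodr_ge0 => i _; exact: normal_lr_ge0. Qed.

Lemma measurable_likelihood s d : measurable_fun setT (likelihood s d).
Proof.
apply: measurable_prod => i _; apply: measurable_fun_normal_lr.
  apply: (measurableT_comp (measurable_dotc d)).
  exact: (measurableT_comp (measurable_tnth i) measurable_fst).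
exact: (measurableT_comp (measurable_tnth i) measurable_snd).
Qed.

(** The planted response is X b + s0 (X d + s g), so planting amounts to an affine change of the
    noise once the design is fixed. *)
Lemma observe_shift b d (s0 s : R) X (g : noise) :
  observe (b + s0 *: d) (s0 * s) (X, g) =
  observe b s0 (X, affine_tuple (fun i => dotc (tnth X i) d) s g).
Proof.
rewrite /observe /regression/=; congr pair; apply/matrixP => i j.
rewrite !mxE tnth_mktuple mulrDr addrA mulrA; congr (_ + _).
rewrite mulr_sumr -big_split/=; apply: eq_bigr => k _.
by rewrite [j]ord1 !mxE; ring.
Qed.

Lemma integral_model_likelihood b d (s0 s : R) (f : 'M[R]_(n, p) * 'cV[R]_n -> \bar R) :
  0 < s0 -> 0 < s -> measurable_fun setT f -> (forall z, 0 <= f z)%E ->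
  (\int[model n (Param (b + s0 *: d) 1%:M (s0 * s))]_z f z =
   \int[ref_law]_w (f (observe b s0 w) * (likelihood s d w)%:E))%E.
Proof.
move=> s00 sp mf f0; rewrite ge0_integral_model ?mulr_gt0//.
have mfo : measurable_fun setT (f \o observe b s0).
  by apply: measurableT_comp => //; exact: measurable_observe.
rewrite fubini_tonelli1; last 2 first.
- by apply: emeasurable_funM => //; apply/measurable_EFinP; exact: measurable_likelihood.
- by move=> w; rewrite mule_ge0// lee_fin likelihood_ge0.
apply: eq_integral => X _; rewrite /fubini_F.
rewrite -(integral_iid_normal_lr (fun i => dotc (tnth X i) d)
  (f := fun g => f (observe b s0 (X, g))) sp)//.
  by apply: eq_integral => g _; rewrite observe_shift.
exact: (measurableT_comp mfo (pair1_measurable _)).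
Qed.

Lemma model_likelihood b d (s0 s : R) A : 0 < s0 -> 0 < s -> measurable A ->
  (model n (Param (b + s0 *: d) 1%:M (s0 * s)) A =
   \int[ref_law]_w (\1_(observe b s0 @^-1` A) w * likelihood s d w)%:E)%E.
Proof.
move=> s00 sp mA.
have := @integral_model_likelihood b d s0 s (fun z => (\1_A z : R)%:E) s00 sp.
rewrite integral_indic// setIT => -> //.
by apply/measurable_EFinP; exact: measurable_indic.
Qed.

Lemma integral_likelihood d (s : R) : 0 < s ->
  (\int[ref_law]_w (likelihood s d w)%:E = 1)%E.
Proof.
(* Any base vector and noise level would serve; 0 and 1 are chosen. *)
move=> sp; rewrite -(probability_setT (model n (Param (0 + 1 *: d) 1%:M (1 * s)))).
rewrite model_likelihood// preimage_setT.
by apply: eq_integral => w _; rewrite indicT mul1r.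
Qed.

Lemma model0E b (s0 : R) A : 0 < s0 -> measurable A ->
  model n (Param b 1%:M s0) A = ref_law (observe b s0 @^-1` A).
Proof.
move=> s00 mA.
(* The null is the planted model with zero spike and s = 1, whose likelihood ratio is identically
   1. *)
have -> : Param b 1%:M s0 = Param (b + s0 *: 0) 1%:M (s0 * 1) by rewrite scaler0 addr0 mulr1.
rewrite model_likelihood//.
transitivity (\int[ref_law]_w (\1_(observe b s0 @^-1` A) w : R)%:E)%E.
  apply: eq_integral => w _; rewrite /likelihood big1 ?mulr1// => i _.
  rewrite /dotc big1 => [|j _]; last by rewrite mxE mulr0.
  by rewrite /normal_lr subr0 expr1n mulr1 subrr expR0 invr1 mulr1.
rewrite integral_indic// ?setIT//.
by rewrite -[X in measurable X]setTI; exact: measurable_observe.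
Qed.

(** The condition s^2 < 2 makes the quadratic coefficient 2 / s^2 - 1 positive, so the second moment
    is finite. *)
Lemma integral_normal_lr2 (s t t' : R) : 0 < s -> s ^+ 2 < 2 ->
  (\int[G]_g (normal_lr s t g * normal_lr s t' g)%:E =
   (s ^- 2 * ((Num.sqrt (2 / s ^+ 2 - 1))^-1 *
     expR ((((t + t') / s ^+ 2) ^+ 2 / (2 / s ^+ 2 - 1) - (t ^+ 2 + t' ^+ 2) / s ^+ 2) / 2)))%:E)%E.
Proof.
move=> s0 s1.
have E : 1 + (2 / s ^+ 2 - 2) = 2 / s ^+ 2 - 1 by ring.
have E0 : 0 < 2 / s ^+ 2 - 1.
  by rewrite subr_gt0 ltr_pdivlMr ?exprn_gt0// mul1r.
rewrite -E [RHS]EFinM -integral_normal_expR_quad ?E// -ge0_integralZl//; last first.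
- by rewrite lee_fin invr_ge0 exprn_ge0 ?ltW.
- exact: measurable_expR_quad.
apply: eq_integral => z _; rewrite -EFinM; congr EFin.
rewrite /normal_lr mulrACA -expRD -invfM -expr2; congr (_ * expR _).
by field; rewrite gt_eqF.
Qed.

(** The observations are independent, so the second moment is the n-th power of the one-row value
    from [integral_row_lr]. *)
Lemma integral_likelihood2 (d d' : 'cV[R]_p) (s : R) : 0 < s ->
  s ^+ 2 + dotc d d = 1 -> s ^+ 2 + dotc d' d' = 1 ->
  (\int[ref_law]_w (likelihood s d w * likelihood s d' w)%:E =
   ((1 - dotc d d')^-1 ^+ n)%:E)%E.
Proof.
move=> s0 hd hd'.
have s2 : s ^+ 2 < 2.
  have : 0 <= dotc d d by apply: sumr_ge0 => i _; rewrite -expr2 sqr_ge0.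
  lra.
(* The noise integral in closed form: a finite, measurable function of the row, as the product
   formula over the design requires. *)
pose h (x : 'cV[R]_p) : R := s ^- 2 * ((Num.sqrt (2 / s ^+ 2 - 1))^-1 *
     expR ((((dotc x d + dotc x d') / s ^+ 2) ^+ 2 / (2 / s ^+ 2 - 1) -
       (dotc x d ^+ 2 + dotc x d' ^+ 2) / s ^+ 2) / 2)).
have mh : measurable_fun setT h.
  have md := measurable_dotc d; have md' := measurable_dotc d'.
  do 2 apply: measurable_funM => //; apply: measurableT_comp => //.
  apply: measurable_funM => //; apply: measurable_funB; apply: measurable_funM => //.
    by apply: measurable_funX; apply: measurable_funM => //; exact: measurable_funD.
  by apply: measurable_funD; exact: measurable_funX.
have h0 x : 0 <= h x.
  by rewrite mulr_ge0 ?invr_ge0 ?exprn_ge0 ?(ltW s0)// mulr_ge0 ?expR_ge0// invr_ge0 sqrtr_ge0.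
have hE x : (\int[G]_g (normal_lr s (dotc x d) g * normal_lr s (dotc x d') g)%:E = (h x)%:E)%E.
  exact: integral_normal_lr2.
rewrite fubini_tonelli1; last 2 first.
- by apply/measurable_EFinP; apply: measurable_funM; exact: measurable_likelihood.
- by move=> w; rewrite lee_fin mulr_ge0// likelihood_ge0.
transitivity (\int[iid (mvnormal (1%:M : 'M[R]_p)) n]_X (\prod_(i < n) h (tnth X i))%:E)%E.
  apply: eq_integral => X _; rewrite /fubini_F -(integral_iid_prod (P := G) (h := fun i g =>
    normal_lr s (dotc (tnth X i) d) g * normal_lr s (dotc (tnth X i) d') g))//.
  - by apply: eq_integral => g _; rewrite /likelihood -big_split.
  - by move=> i; apply: measurable_funM; exact: measurable_normal_lr.
  - by move=> i x; rewrite mulr_ge0// normal_lr_ge0.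
rewrite (integral_iid_prod (h := fun=> h) (c := fun=> (1 - dotc d d')^-1))//.
  by rewrite prodr_const card_ord.
by move=> i; rewrite -(integral_row_lr s0 hd hd'); apply: eq_integral => x _; rewrite hE.
Qed.

End likelihood.

(** * Spikes and their separation *)

Section spikes.
Context {R : realType} (p m B : nat) (hB : (m * B <= p)%N).

Lemma slot_subproof (i : 'I_m) (b : 'I_B) : (i * B + b < p)%N.
Proof.
apply: leq_trans hB; apply: (@leq_trans (i.+1 * B)); last by rewrite leq_mul2r ltn_ord orbT.
by rewrite mulSn addnC ltn_add2r.
Qed.

Definition slot i b : 'I_p := Ordinal (slot_subproof i b).

Lemma slot_inj i i' b b' : slot i b = slot i' b' -> i = i' /\ b = b'.
Proof.
move=> /(congr1 val) /= e.
have hi : i = i' :> nat.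
  have B0 : (0 < B)%N by apply: leq_trans (ltn_ord b).
  have := congr1 (divn^~ B) e.
  by rewrite !divnMDl// !divn_small ?addn0.
split; first exact: val_inj.
by apply: val_inj; move: e; rewrite hi => /addnI.
Qed.

Definition support (f : {ffun 'I_m -> 'I_B}) : {set 'I_p} := [set slot i (f i) | i : 'I_m]%SET.

(** The blocks are disjoint, so two supports meet exactly in the blocks where the picks agree. *)
Lemma card_supportI f g :
  #|(support f :&: support g)%SET| = #|[set i | f i == g i]%SET|.
Proof.
rewrite -(card_imset [set i | f i == g i]%SET (f := fun i => slot i (f i))); last first.
  by move=> i j /slot_inj[].
apply: eq_card => j; rewrite !inE; apply/andP/imsetP => [[/imsetP[i _ ->] /imsetP[i' _ e]]|[i]].
  by have [ii fg] := slot_inj e; exists i; rewrite // inE fg ii.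
rewrite inE => /eqP fg ->; split; first exact: imset_f.
by rewrite fg; apply: imset_f.
Qed.

Lemma card_support f : #|support f| = m.
Proof.
by rewrite card_imset ?card_ord// => i j /slot_inj[].
Qed.

Definition spike (r : R) f : 'cV[R]_p := \col_j (r *+ (j \in support f)).

Lemma dotc_spike r f g :
  dotc (spike r f) (spike r g) = r ^+ 2 * #|[set i | f i == g i]%SET|%:R.
Proof.
rewrite -card_supportI /dotc -sum1_card natr_sum mulr_sumr [RHS]big_mkcond/=.
apply: eq_bigr => j _; rewrite !mxE inE.
by case: (_ \in _); case: (_ \in _); rewrite ?mulr0 ?mul0r// mulr1 expr2.
Qed.

Lemma l0norm_addspike (b : 'cV[R]_p) c r f :
  (l0norm (b + c *: spike r f) <= l0norm b + m)%N.
Proof.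
rewrite -[X in (_ + X)%N](card_support f); apply: leq_trans (leq_card_setU _ _).
apply: subset_leq_card; apply/fintype.subsetP => j; rewrite !inE !mxE.
case: (j \in support f); first by rewrite orbT.
by rewrite mulr0n mulr0 addr0 orbF.
Qed.

Lemma lqnorm_spike q c r f : 0 < q -> 0 <= c -> 0 <= r ->
  lqnorm q (c *: spike r f) = m%:R `^ q^-1 * (c * r).
Proof.
move=> q0 c0 r0.
have -> : lqnorm q (c *: spike r f) = (m%:R * (c * r) `^ q) `^ q^-1.
  congr (_ `^ _); rewrite -[in RHS](card_support f) -sum1_card natr_sum mulr_suml.
  rewrite [RHS]big_mkcond/=; apply: eq_bigr => j _; rewrite !mxE.
  case: (_ \in _); first by rewrite mul1r mulr1n ger0_norm ?mulr_ge0.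
  by rewrite mulr0n mulr0 normr0 powR0// gt_eqF.
rewrite powRM ?ler0n ?powR_ge0// -powRrM mulfV ?gt_eqF// powRr1// mulr_ge0//.
Qed.

(** Picks are free in each block, so the sum factors over blocks: the agreeing pick contributes E
    and each of the other B - 1 picks contributes 1. *)
Lemma sum_agree (E : R) (f : {ffun 'I_m -> 'I_B}) : (0 < B)%N ->
  \sum_(g : {ffun 'I_m -> 'I_B}) E ^+ #|[set i | f i == g i]%SET| = (B%:R - 1 + E) ^+ m.
Proof.
move=> B0.
transitivity (\sum_(g : {ffun 'I_m -> 'I_B}) \prod_(i < m) (if f i == g i then E else 1)).
  apply: eq_bigr => g _; rewrite -big_mkcond/= -prodr_const.
  by apply: eq_bigl => i; rewrite inE.
rewrite -(bigA_distr_bigA (fun i b => if f i == b then E else 1))/=.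
transitivity (\prod_(i < m) (B%:R - 1 + E)); last by rewrite prodr_const card_ord.
apply: eq_bigr => i _; rewrite (bigD1 (f i))//= eqxx addrC; congr (_ + _).
rewrite (eq_bigr (fun=> 1)) => [|b]; last by rewrite eq_sym => /negbTE ->.
rewrite sumr_const; have -> : #|[pred b | b != f i]| = B.-1.
  by rewrite cardC1 card_ord.
by rewrite -subn1 natrB.
Qed.

End spikes.

Section lq.
Context {R : realType}.

Lemma powR_le_self (x q : R) : 0 <= x <= 1 -> 1 <= q -> x `^ q <= x.
Proof.
move=> /andP[x0 x1] q1; have [->|xn0] := eqVneq x 0.
  by rewrite powR0// gt_eqF// (lt_le_trans _ q1).
by rewrite -[leRHS]powRr1// ger_powR// x1 andbT lt_neqAle eq_sym xn0.
Qed.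

Lemma powR_normD (q x y : R) : 0 <= q ->
  `|x + y| `^ q <= 2 `^ q * (`|x| `^ q + `|y| `^ q).
Proof.
move=> q0; set M := Num.max `|x| `|y|.
apply: (@le_trans _ _ ((2 * M) `^ q)).
  apply: ge0_ler_powR; rewrite ?nnegrE ?normr_ge0// ?mulr_ge0 ?le_max ?normr_ge0//.
  rewrite mulrDl mul1r (le_trans (ler_normD _ _))// lerD// /M le_max lexx ?orbT//.
rewrite powRM// ?le_max ?normr_ge0//; apply: ler_wpM2l; first exact: powR_ge0.
have [->|->] : M = `|x| \/ M = `|y| by rewrite /M; case: leP; auto.
  by rewrite lerDl powR_ge0.
by rewrite lerDr powR_ge0.
Qed.

Lemma lqnorm_powR p (q : R) (x : 'cV[R]_p) : 0 < q ->
  lqnorm q x `^ q = \sum_(i < p) `|x i 0| `^ q.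
Proof.
by move=> q0; rewrite -powRrM mulVf ?gt_eqF// powRr1// sumr_ge0.
Qed.

Lemma lqnorm_ge0 p (q : R) (x : 'cV[R]_p) : 0 <= lqnorm q x.
Proof. exact: powR_ge0. Qed.

(** Otherwise [powR_normD], summed over coordinates, would give D^q <= D^q ((2/5)^q + (1/2)^q) <=
    (9/10) D^q. The crude factor 2^q dictates the constants 4 and 5. *)
Lemma lqnorm_separation p (q D : R) (u w : 'cV[R]_p) : 1 <= q -> 0 < D ->
  lqnorm q w = D -> lqnorm q u <= D / 5 -> D / 4 <= lqnorm q (u - w).
Proof.
have c1 : 2 / 5 + 1 / 2 < 1 :> R by lra.
have c2 : 0 <= (2 / 5 : R) <= 1 by apply/andP; split; lra.
have c3 : 0 <= (1 / 2 : R) <= 1 by apply/andP; split; lra.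
move=> q1 D0 wD uD.
have q0 : 0 < q by rewrite (lt_le_trans _ q1).
rewrite leNgt; apply/negP => vD.
have mono (x y : R) : 0 <= x -> x <= y -> x `^ q <= y `^ q.
  move=> x0 xy; have y0 := le_trans x0 xy.
  by apply: ge0_ler_powR; rewrite ?nnegrE// ltW.
have uq := mono _ _ (lqnorm_ge0 q u) uD.
have vq := mono _ _ (lqnorm_ge0 q (u - w)) (ltW vD).
have : \sum_(i < p) `|w i 0| `^ q <=
    2 `^ q * (\sum_(i < p) `|u i 0| `^ q + \sum_(i < p) `|(u - w) i 0| `^ q).
  rewrite [X in _ * X](esym (big_split _ _ _ _ _)) mulr_sumr; apply: ler_sum => i _.
  have -> : w i 0 = u i 0 + - (u - w) i 0 by rewrite !mxE opprB addrC subrK.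
  by rewrite -(normrN ((u - w) i 0)) powR_normD ?ltW.
rewrite -(lqnorm_powR w q0) -(lqnorm_powR u q0) -(lqnorm_powR (u - w) q0) wD.
apply/negP; rewrite -ltNge.
have Dq : 0 < D `^ q by rewrite powR_gt0.
apply: (@le_lt_trans _ _ (D `^ q * (2 / 5 + 1 / 2))); last by rewrite gtr_pMr.
have D5 : 0 < D / 5 by rewrite divr_gt0.
have D4 : 0 < D / 4 by rewrite divr_gt0.
apply: (@le_trans _ _ (2 `^ q * ((D / 5) `^ q + (D / 4) `^ q))).
  by rewrite ler_pM2l ?powR_gt0// lerD.
rewrite mulrDr -(powRM _ (ler0n R 2) (ltW D5)) -(powRM _ (ler0n R 2) (ltW D4)).
have -> : 2 * (D / 5) = D * (2 / 5) by ring.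
have -> : 2 * (D / 4) = D * (1 / 2) by field.
have [[c20 _] [c30 _]] := (andP c2, andP c3).
rewrite (powRM _ (ltW D0) c20) (powRM _ (ltW D0) c30) -mulrDr ler_pM2l//.
by rewrite lerD// powR_le_self.
Qed.

End lq.

(** * The chi-square bound *)

Section chi_square.
Context {R : realType}.

Lemma expR_le_onemV (x : R) : x < 1 -> expR x <= (1 - x)^-1.
Proof.
move=> x1; rewrite -[leLHS]invrK -expRN lef_pV2 ?posrE ?expR_gt0 ?subr_gt0//.
by have := expR_ge1Dx (- x).
Qed.

Lemma onemV_le_expR (x : R) : 0 <= x -> x <= 1 / 2 -> (1 - x)^-1 <= expR (2 * x).
Proof.
move=> x0 x1; apply: le_trans (expR_ge1Dx _); have x2 : 0 < 1 - x by lra.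
rewrite -[leLHS]mul1r ler_pdivrMr//; nra.
Qed.

(** With J agreeing blocks, (1 - r^2 J)^-n <= exp (lam J). Summing over g gives (B - 1 + exp lam)^m
    <= B^m exp (m (exp lam - 1) / B) <= B^m exp (1/162), and exp (1/162) <= 1 / (1 - 1/162) = 1 +
    1/161. *)
Lemma sum_chi2_le (m B n : nat) (r lam : R) : (0 < B)%N -> 0 <= lam ->
  n%:R * (2 * r ^+ 2) = lam -> r ^+ 2 * m%:R <= 1 / 2 ->
  m%:R * expR lam <= 162^-1 * B%:R ->
  \sum_(f <- enum {: {ffun 'I_m -> 'I_B}}) \sum_(g <- enum {: {ffun 'I_m -> 'I_B}})
     (1 - r ^+ 2 * #|[set i | f i == g i]%SET|%:R)^-1 ^+ n <=
  (size (enum {: {ffun 'I_m -> 'I_B}}))%:R ^+ 2 * (1 + 161^-1).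
Proof.
move=> B0 lam0 lamE rm mE; rewrite -cardE card_ffun !card_ord.
have B0' : 0 < B%:R :> R by rewrite ltr0n.
have c161 : (1 - 162^-1)^-1 = 1 + 161^-1 :> R by field.
have c162 : 162^-1 < 1 :> R by lra.
set N : R := (B ^ m)%:R.
have inner (f : {ffun 'I_m -> 'I_B}) : \sum_(g <- enum {: {ffun 'I_m -> 'I_B}})
     (1 - r ^+ 2 * #|[set i | f i == g i]%SET|%:R)^-1 ^+ n <= N * (1 + 161^-1).
  apply: (@le_trans _ _ (\sum_(g : {ffun 'I_m -> 'I_B}) expR lam ^+ #|[set i | f i == g i]%SET|)).
    rewrite big_enum; apply: ler_sum => g _; set J := #|_|.
    have Jm : (J <= m)%N by rewrite -[leqRHS]card_ord max_card.
    have k0 : 0 <= r ^+ 2 * J%:R by rewrite mulr_ge0 ?sqr_ge0.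
    have k1 : r ^+ 2 * J%:R <= 1 / 2.
      by apply: le_trans rm; rewrite ler_wpM2l ?sqr_ge0// ler_nat.
    rewrite -expRM_natl -lamE.
    have -> : J%:R * (n%:R * (2 * r ^+ 2)) = n%:R * (2 * (r ^+ 2 * J%:R)) by ring.
    rewrite expRM_natl lerXn2r ?nnegrE ?expR_ge0 ?onemV_le_expR//.
    by rewrite invr_ge0 subr_ge0 (le_trans k1)// ler_pdivrMr// mul1r ler1n.
  rewrite sum_agree//.
  have -> : B%:R - 1 + expR lam = B%:R * (1 + (expR lam - 1) / B%:R) by field; rewrite gt_eqF.
  rewrite exprMn -natrX; apply: ler_wpM2l; first exact: ler0n.
  have e1 : 1 <= expR lam by rewrite -expR0 ler_expR.
  apply: (@le_trans _ _ (expR ((expR lam - 1) / B%:R) ^+ m)).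
    rewrite lerXn2r ?nnegrE ?expR_ge0 ?expR_ge1Dx//.
    by rewrite addr_ge0// divr_ge0 ?subr_ge0.
  rewrite -expRM_natl -c161; apply: le_trans (expR_le_onemV c162).
  rewrite ler_expR mulrA ler_pdivrMr//; apply: le_trans mE.
  by rewrite ler_wpM2l// gerBl.
apply: (@le_trans _ _ (\sum_(f <- enum {: {ffun 'I_m -> 'I_B}}) N * (1 + 161^-1))).
  by apply: ler_sum => f _; exact: inner.
rewrite big_enum sumr_const card_ffun !card_ord -[leLHS]mulr_natl -/N.
by rewrite mulrA expr2.
Qed.

Lemma model_le_planted (n p m B : nat) (hB : (m * B <= p)%N) (b : 'cV[R]_p)
    (s0 r lam delta : R) (A : set ('M[R]_(n, p) * 'cV[R]_n)) :
  (0 < B)%N -> 0 < s0 -> 0 <= lam ->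
  n%:R * (2 * r ^+ 2) = lam -> r ^+ 2 * m%:R <= 1 / 2 ->
  m%:R * expR lam <= 162^-1 * B%:R -> measurable A ->
  (forall f, model n (Param (b + s0 *: spike hB r f) 1%:M
     (s0 * Num.sqrt (1 - r ^+ 2 * m%:R))) A <= delta%:E)%E ->
  (model n (Param b 1%:M s0) A <= (delta + 1 / 10)%:E)%E.
Proof.
move=> B0 s00 lam0 lamE rm mE mA hA; rewrite model0E//.
set s := Num.sqrt _ in hA.
have s2 : s ^+ 2 = 1 - r ^+ 2 * m%:R by rewrite sqr_sqrtr//; lra.
have sp : 0 < s by rewrite sqrtr_gt0; lra.
(* A spike has squared norm r^2 m, and the noise is lowered by exactly this much. *)
have dd f : s ^+ 2 + dotc (spike hB r f) (spike hB r f) = 1.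
  rewrite dotc_spike (_ : [set i | f i == f i]%SET = [set: 'I_m]%SET).
    by rewrite cardsT card_ord s2 subrK.
  by apply/setP => i; rewrite !inE eqxx.
have sz : (0 < size (enum {: {ffun 'I_m -> 'I_B}}))%N.
  by rewrite -cardE card_ffun !card_ord expn_gt0 B0.
(* With eta = 1/161 and t = 1/10 the loss t / 2 + eta / (2 t) = 1/20 + 5/161 is below 1/10. *)
have := @le_mixture _ _ _ (ref_law n p) {ffun 'I_m -> 'I_B} (enum {: {ffun 'I_m -> 'I_B}})
  (fun f => likelihood s (spike hB r f))
  (fun f g => (1 - r ^+ 2 * #|[set i | f i == g i]%SET|%:R)^-1 ^+ n)
  (observe b s0 @^-1` A) delta 161^-1 (1 / 10) sz.
have c10 : 0 < 1 / 10 :> R by lra.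
move=> /(_ c10) H; apply: (le_trans (H _ _ _ _ _ _ _)) => {H}.
- by move=> f; exact: measurable_likelihood.
- by move=> f w; exact: likelihood_ge0.
- by move=> f _; exact: integral_likelihood.
- by move=> f g _ _; rewrite integral_likelihood2// dotc_spike.
- exact: sum_chi2_le lamE rm mE.
- by rewrite -[X in measurable X]setTI; exact: measurable_observe.
- by move=> f _; rewrite -model_likelihood.
- by rewrite lee_fin; lra.
Qed.

End chi_square.

(** * Membership in the parameter space, measurability of the loss, bounds on [c0] *)

Section auxiliary.
Context {R : realType}.

Lemma identity_in_Theta p (b : 'cV[R]_p) (M1 M2 s : R) k :
  (0 < p)%N -> (l0norm b <= k)%N -> 1 <= M1 -> 0 < s -> s <= M2 ->
  Theta M1 M2 k (Param b 1%:M s).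
Proof.
move=> p0 bk M11 s0 sM.
have E : [set a : R | eigenvalue (1%:M : 'M[R]_p) a] = [set 1].
  apply/seteqP; split=> a /=.
    case/eigenvalueP => v; rewrite mulmx1 => /eqP; rewrite -subr_eq0 -[X in X - _]scale1r -scalerBl.
    by rewrite scaler_eq0 => /orP[|-> //]; rewrite subr_eq0 => /eqP.
  (* The all-ones vector is nonzero because p > 0. *)
  move=> ->; apply/eigenvalueP; exists (const_mx 1); first by rewrite mulmx1 scale1r.
  apply/eqP => /matrixP/(_ 0 (Ordinal p0)); rewrite !mxE => /eqP.
  by rewrite oner_eq0.
rewrite /Theta/= /lambda_min /lambda_max E inf1 sup1; split=> //.
- by rewrite tr_scalar_mx.
- by rewrite invf_le1// (lt_le_trans ltr01).
- by rewrite lexx.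
- by rewrite s0.
Qed.

Lemma measurable_lqnorm_err d (T : measurableType d) p (q : R) (b : 'cV[R]_p) (h : T -> 'cV[R]_p) :
  measurable_fun setT h -> measurable_fun setT (fun z => lqnorm q (h z - b) ^+ 2).
Proof.
move=> mh; apply: measurable_funX.
apply: (measurableT_comp (measurable_powR _)).
apply: measurable_sum => i; apply: (measurableT_comp (measurable_powR _)).
apply: measurableT_comp => //.
under eq_fun do rewrite !mxE.
apply: measurable_funB => //.
exact: (measurableT_comp (measurable_entry i 0) mh).
Qed.

(** Since [epsilon1] is at most 1/12 and sqrt (ln (1 + e^2)) <= e, the term with factor 2/3 gives
    1/18. The second bound comes from the term r^2. *)
Lemma c0_bounds (alpha alpha0 C gamma : R) :
  0 < alpha < 1 / 4 -> 0 <= alpha0 < 1 / 4 -> 0 < C -> 0 <= gamma < 1 / 2 ->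
  c0 alpha alpha0 C gamma <= 1 / 18 /\ C * c0 alpha alpha0 C gamma <= (1 - 2 * gamma) / 64.
Proof.
move=> /andP[a0 a1] /andP[b0 b1] C0 /andP[g0 g1].
set c := c0 _ _ _ _; pose e := epsilon1 alpha alpha0; pose r := (1 - 2 * gamma) / (16 * C).
have cmin : [/\ c <= 2 / 3 * Num.sqrt (ln (1 + e ^+ 2)) & c <= r ^+ 2].
  by rewrite /c /c0 !ge_min -/e -/r !lexx !orbT.
have [ce cr] := cmin.
have e0 : 0 <= e by rewrite /e /epsilon1; lra.
have e1 : e <= 1 / 12 by rewrite /e /epsilon1; lra.
have le : Num.sqrt (ln (1 + e ^+ 2)) <= e.
  rewrite -[leRHS]ger0_norm// -sqrtr_sqr ler_sqrt ?sqr_ge0//.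
  by apply: le_ln1Dx; apply: lt_le_trans (sqr_ge0 e); rewrite ltrN10.
have c18 : c <= 1 / 18 by clear -ce le e1; lra.
split=> //.
have r0 : 0 < r by rewrite divr_gt0; lra.
(* If c > r / 4, then r < 4 c <= 2/9, so c <= r^2 < r / 4. *)
have cr4 : c <= r / 4.
  by clear -cr c18 r0; rewrite leNgt; apply/negP => h; nra.
have -> : (1 - 2 * gamma) / 64 = C * (r / 4) by rewrite /r; field; rewrite gt_eqF.
by rewrite ler_pM2l.
Qed.

End auxiliary.

(** * The lower bound *)

Section numerics.
Context {R : realType}.

(** Checks the hypotheses of [model_le_planted] for the chosen m, r and block length p %/ m; here
    exp lam is p ^ (1 - 2 gamma). *)
Lemma sparsity_scaling (gamma c : R) (n p k k0 : nat) :
  0 <= gamma < 1 / 2 -> c <= 1 / 18 -> (0 < n)%N -> (0 < p)%N -> (0 < k)%N ->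
  k%:R <= c * Num.min (p%:R `^ gamma) (n%:R / ln p%:R) -> k0%:R <= c * k%:R ->
  let m := (k - k0)%N in let r := Num.sqrt ((1 - 2 * gamma) / 2 * (ln p%:R / n%:R)) in
  let lam := (1 - 2 * gamma) * ln p%:R in
  [/\ 0 < c, 0 < ln (p%:R : R), (k0 * 18 <= k)%N,
      (0 < p %/ m)%N /\ r ^+ 2 * m%:R <= 1 / 2 &
      n%:R * (2 * r ^+ 2) = lam /\ m%:R * expR lam <= 162^-1 * (p %/ m)%:R].
Proof.
move=> /andP[g0 g1] c18 n0 p0 k0' hk hk0 m r lam.
have k1 : 1 <= k%:R :> R by rewrite ler1n.
have n0' : 0 < n%:R :> R by rewrite ltr0n.
have p0' : 0 < p%:R :> R by rewrite ltr0n.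
have lp0 : 0 <= ln (p%:R : R) by rewrite ln_ge0// ler1n.
set lp := ln _ in hk lp0 r lam *.
have min0 : 0 <= Num.min (p%:R `^ gamma) (n%:R / lp).
  by rewrite le_min powR_ge0 divr_ge0// ltW.
have c0 : 0 < c.
  by rewrite ltNge; apply/negP => c0; have := mulr_ge0 (y := - c) min0; nra.
have hk1 : k%:R <= c * p%:R `^ gamma.
  by apply: le_trans hk _; rewrite ler_pM2l// ge_min lexx.
have hk2 : k%:R <= c * (n%:R / lp).
  by apply: le_trans hk _; rewrite ler_pM2l// ge_min lexx orbT.
(* For p = 1 the convention 1 / 0 = 0 makes the bound on k zero, against k >= 1. *)
have lp1 : 0 < lp.
  rewrite lt_neqAle lp0 andbT eq_sym; apply/eqP => lpE.
  by move: hk2; rewrite lpE invr0 !mulr0; lra.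
have kL : k%:R * (lp / n%:R) <= c.
  by rewrite mulrA ler_pdivrMr// -ler_pdivlMr// -mulrA.
have k18 : (k0 * 18 <= k)%N by rewrite -(ler_nat R) natrM; nra.
have m0 : (0 < m)%N by rewrite /m; clear -k18 k0'; lia.
have m0' : 0 < m%:R :> R by rewrite ltr0n.
have mk : m%:R <= k%:R :> R by rewrite ler_nat leq_subr.
have pE : p%:R = expR lp by rewrite /lp lnK// posrE.
have pg : p%:R `^ gamma = expR (gamma * lp) by rewrite /powR gt_eqF.
have pgp : p%:R `^ gamma <= p%:R.
  by rewrite pg [leRHS]pE ler_expR; nra.
have mp : (m <= p)%N by rewrite -(ler_nat R); nra.
have B0 : (0 < p %/ m)%N by rewrite divn_gt0.
have r2 : r ^+ 2 = (1 - 2 * gamma) / 2 * (lp / n%:R).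
  rewrite sqr_sqrtr// mulr_ge0//; first by lra.
  by rewrite divr_ge0// ltW.
have L0 : 0 <= lp / n%:R by rewrite divr_ge0// ltW.
have rm : r ^+ 2 * m%:R <= 1 / 2.
  rewrite r2 -mulrA (mulrC _ m%:R).
  have mL : m%:R * (lp / n%:R) <= c by apply: le_trans kL; rewrite ler_wpM2r.
  have mL0 : 0 <= m%:R * (lp / n%:R) by rewrite mulr_ge0.
  by clear -mL mL0 c18 g0 g1; nra.
split=> //; split.
  by rewrite r2 /lam; field; rewrite gt_eqF.
set B := (p %/ m)%N in B0 *.
(* p < (B + 1) m <= 2 B m, as B >= 1. *)
have pB : p%:R <= 2 * B%:R * m%:R :> R.
  rewrite -!natrM ler_nat.
  by move: (ltn_ceil p m0) B0; rewrite -/B; clear; nia.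
(* m^2 <= c^2 p ^ (2 gamma), and exp lam supplies the missing power of p. Dividing by m then gives m
   exp lam <= 2 c^2 B <= 2 B / 18^2 = B / 162. *)
have mmE : m%:R * (m%:R * expR lam) <= c ^+ 2 * p%:R.
  have -> : c ^+ 2 * p%:R = (c * p%:R `^ gamma) * (c * p%:R `^ gamma) * expR lam.
    rewrite [in LHS]pE pg /lam.
    have -> : expR lp = expR (gamma * lp) * expR (gamma * lp) * expR ((1 - 2 * gamma) * lp).
      by rewrite -!expRD; congr expR; ring.
    by ring.
  rewrite mulrA ler_pM2r ?expR_gt0//; apply: ler_pM; rewrite ?ler0n//; exact: le_trans hk1.
rewrite -(ler_pM2l m0'); apply: le_trans mmE _.
apply: (@le_trans _ _ (c ^+ 2 * (2 * B%:R * m%:R))); first by rewrite ler_wpM2l ?sqr_ge0.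
have -> : m%:R * (162^-1 * B%:R) = (18^-1 ^+ 2) * (2 * B%:R * m%:R) :> R by field.
rewrite ler_wpM2r ?mulr_ge0// lerXn2r ?nnegrE ?invr_ge0 ?(ltW c0)//.
by rewrite -div1r.
Qed.

(** Shows that the allowed loss at the null is at most 1/25 of the squared norm of the spike. As e
    >= 1, the small ratio y = 18 c / 17 satisfies y^e <= y, and (18/17) / 32 < 1/25. *)
Lemma powR_gap (e c C a K m : R) : 1 <= e -> 0 <= c -> c <= 1 / 18 -> 0 <= C ->
  0 <= a -> C * c <= a / 32 -> 0 <= K -> 0 < m -> K <= 18 / 17 * c * m ->
  C * K `^ e <= m `^ e * a / 25.
Proof.
move=> e1 c0 c18 C0 a0 Cc K0 m0 Km; set y := 18 / 17 * c.
have y01 : 0 <= y <= 1 by rewrite /y; apply/andP; split; lra.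
have [y0 _] := andP y01.
have Ky : K `^ e <= y * m `^ e.
  apply: (@le_trans _ _ ((y * m) `^ e)).
    apply: ge0_ler_powR; rewrite ?nnegrE//; first exact: le_trans e1.
    exact: le_trans Km.
  by rewrite (powRM _ y0 (ltW m0)) ler_wpM2r ?powR_ge0// powR_le_self.
apply: (@le_trans _ _ (C * (y * m `^ e))); first by rewrite ler_wpM2l.
have -> : C * (y * m `^ e) = m `^ e * (C * c * (18 / 17)) by rewrite /y; ring.
by rewrite -[leRHS]mulrA ler_wpM2l ?powR_ge0//; clear -Cc a0; lra.
Qed.

Lemma powR_double (e k m : R) : 0 <= e <= 2 -> 0 <= k -> 0 <= m -> k <= 2 * m ->
  k `^ e <= 4 * m `^ e.
Proof.
move=> /andP[e0 e2] k0 m0 km.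
apply: (@le_trans _ _ ((2 * m) `^ e)).
  by apply: ge0_ler_powR; rewrite ?nnegrE// mulr_ge0.
rewrite powRM// ler_wpM2r ?powR_ge0//.
have -> : 4 = 2 `^ 2 :> R by rewrite powR_mulrn// -natrX.
by apply: ler_powR => //; rewrite ler1n.
Qed.

(** Origin of 800 = 2 * 4 * 100: the 2 from r^2, the 4 from replacing k by m, the 100 from the gap
    in [dist_gap]. *)
Lemma gap_le (kap s2 ke me L : R) : 0 <= kap -> 0 <= s2 -> 0 <= L -> ke <= 4 * me ->
  kap * s2 / 800 * ke * L <= me * (s2 * (kap / 2 * L)) / 100.
Proof.
move=> kap0 s20 L0 h.
have -> : me * (s2 * (kap / 2 * L)) / 100 = kap * s2 / 800 * (4 * me) * L by field.
have w0 : 0 <= kap * s2 / 800 by apply: divr_ge0; [exact: mulr_ge0|exact: ler0n].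
move: (kap * s2 / 800) w0 => w w0.
by apply: ler_wpM2r => //; apply: ler_wpM2l.
Qed.

(** Here x < D/25 + D/100 = D/20 while v >= D/16, and the difference D/80 exceeds D/100. *)
Lemma dist_gap (x u v w D cr : R) : u <= w -> w <= D / 25 -> `|x - u| < cr ->
  D / 16 <= v -> cr <= D / 100 -> 0 < D -> cr <= `|x - v|.
Proof.
move=> uw wD; rewrite ltr_norml => /andP[_ xu] vD crD D0.
by rewrite distrC; apply: le_trans (ler_norm _); lra.
Qed.

End numerics.

(** The two-point contradiction: the event that the null loss is small and well estimated has null
    probability above 1/2, yet on it every planted loss is badly estimated, which by transfer from
    the mixture caps the probability at 1/4 + 1/10. *)
Lemma no_loss_estimator (R : realType) (q alpha0 Cstar gamma sigma0 M1 M2 c : R)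
    (n p k k0 : nat) (b : 'cV[R]_p)
    (betahat : 'M[R]_(n, p) * 'cV[R]_n -> 'cV[R]_p) (Lhat : 'M[R]_(n, p) * 'cV[R]_n -> R) :
  1 <= q <= 2 -> 0 <= alpha0 < 1 / 4 -> 0 < Cstar -> 0 <= gamma < 1 / 2 -> 0 < sigma0 ->
  1 <= M1 -> sigma0 <= M2 -> c <= 1 / 18 -> Cstar * c <= (1 - 2 * gamma) / 64 ->
  (0 < n)%N -> (0 < p)%N -> (0 < k)%N ->
  k%:R <= c * Num.min (p%:R `^ gamma) (n%:R / ln p%:R) -> k0%:R <= c * k%:R ->
  (l0norm b <= k0)%N ->
  measurable_fun setT betahat -> measurable_fun setT Lhat ->
  (model n (Param b 1%:M sigma0)
     [set z | (Cstar * (l0norm b)%:R `^ (2 / q) * (ln p%:R / n%:R) * sigma0 ^+ 2 <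
               lqnorm q (betahat z - b) ^+ 2)%R] <= alpha0%:E)%E ->
  (forall theta, Theta M1 M2 k theta ->
    model n theta
      [set z | ((1 - 2 * gamma) * sigma0 ^+ 2 / 800 * k%:R `^ (2 / q) * (ln p%:R / n%:R) <=
                `| Lhat z - lqnorm q (betahat z - beta theta) ^+ 2 |)%R] <= (1 / 4)%:E)%E ->
  False.
Proof.
move=> /andP[q1 q2] /andP[al0 al1] C0 hg sg0 M11 sM c18 Cc n0 p0 kp hk hk0 bk0 mb mL hyp sup.
have [c0' lp0 k18 [B0 rm] [lamE mE]] := sparsity_scaling hg c18 n0 p0 kp hk hk0.
set m := (k - k0)%N in B0 rm mE; set r := Num.sqrt _ in rm lamE.
set lam := (1 - 2 * gamma) * _ in lamE mE.
set B := (p %/ m)%N in B0 mE.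
have hB : (m * B <= p)%N by rewrite mulnC leq_trunc_div.
have [g0 g1] := andP hg.
have q0 : 0 < q by clear -q1; lra.
set L := ln p%:R / n%:R in r rm lamE hyp sup.
have L0 : 0 < L by rewrite divr_gt0// ltr0n.
pose a : R := (1 - 2 * gamma) / 2; have a0 : 0 < a by rewrite /a; clear -g1; lra.
have r2 : r ^+ 2 = a * L by rewrite sqr_sqrtr// mulr_ge0// ltW.
have r0 : 0 <= r by rewrite sqrtr_ge0.
have m0 : (0 < m)%N by rewrite /m; clear -k18 kp; lia.
have m0' : 0 < m%:R :> R by rewrite ltr0n.
set e := 2 / q in hyp sup.
have e1 : 1 <= e by rewrite /e ler_pdivlMr// mul1r.
have e2 : 0 <= e <= 2.
  apply/andP; split; first by rewrite divr_ge0// ltW.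
  by rewrite /e ler_pdivrMr//; clear -q1; lra.
(* The l_q norm of every scaled spike. *)
pose D := m%:R `^ q^-1 * (sigma0 * r).
have D2 : D ^+ 2 = m%:R `^ e * (sigma0 ^+ 2 * (a * L)).
  rewrite /D !exprMn r2; congr (_ * _).
  by rewrite -powR_mulrn ?powR_ge0// -powRrM /e mulrC.
have me0 : 0 < m%:R `^ e by rewrite powR_gt0.
have s20 : 0 < sigma0 ^+ 2 by rewrite exprn_gt0.
have D20 : 0 < D ^+ 2.
  by rewrite D2; apply: mulr_gt0 => //; apply: mulr_gt0 => //; exact: mulr_gt0.
have D0 : 0 < D.
  have Dge0 : 0 <= D by rewrite /D mulr_ge0 ?powR_ge0// mulr_ge0// ltW.
  by rewrite lt_neqAle Dge0 andbT eq_sym -(sqrf_eq0 D) gt_eqF.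
set U := Cstar * _ * L * sigma0 ^+ 2 in hyp.
(* From k0 <= k / 18, so m = k - k0 is at least 17 k / 18. *)
have km : k%:R <= 18 / 17 * m%:R :> R.
  have : (17 * k <= 18 * m)%N by rewrite /m; clear -k18; lia.
  by rewrite -(ler_nat R) !natrM => h; clear -h; lra.
have UD : U <= D ^+ 2 / 25.
  have : Cstar * (l0norm b)%:R `^ e <= m%:R `^ e * a / 25.
    have Cca : Cstar * c <= a / 32 by rewrite /a; clear -Cc; lra.
    have Kb : (l0norm b)%:R <= 18 / 17 * c * m%:R.
      apply: (@le_trans _ _ k0%:R); first by rewrite ler_nat.
      by apply: le_trans hk0 _; clear -km c0'; nra.
    exact: (powR_gap e1 (ltW c0') c18 (ltW C0) (ltW a0) Cca (ler0n _ _) m0' Kb).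
  move=> h; rewrite /U D2.
  have -> : m%:R `^ e * (sigma0 ^+ 2 * (a * L)) / 25 = (m%:R `^ e * a / 25) * L * sigma0 ^+ 2 by ring.
  by rewrite !ler_pM2r.
set cr := _ / 800 * _ * L in sup.
have crD : cr <= D ^+ 2 / 100.
  have k4 : k%:R `^ e <= 4 * m%:R `^ e.
    by apply: powR_double => //; clear -km m0'; lra.
  rewrite D2; apply: gap_le k4; [clear -g1; lra|exact: ltW|exact: ltW].
pose g z := lqnorm q (betahat z - b) ^+ 2.
have mg : measurable_fun setT g by exact: measurable_lqnorm_err.
have mabs (b' : 'cV[R]_p) : measurable [set z | cr <= `|Lhat z - lqnorm q (betahat z - b') ^+ 2|].
  have mh : measurable_fun setT (fun z => `|Lhat z - lqnorm q (betahat z - b') ^+ 2|).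
    have mB := measurable_funB mL (measurable_lqnorm_err q b' mb).
    exact: (measurableT_comp (@normr_measurable R setT) mB).
  have := mh measurableT _ (measurable_itv `[cr, +oo[); rewrite setTI.
  by congr measurable; apply/seteqP; split=> z /=; rewrite in_itv/= andbT.
set E1 := [set z | _] in hyp.
have mE1 : measurable E1.
  have := mg measurableT _ (measurable_itv `]U, +oo[); rewrite setTI.
  by congr measurable; apply/seteqP; split=> z /=; rewrite in_itv/= andbT.
pose E2 := [set z | cr <= `|Lhat z - lqnorm q (betahat z - b) ^+ 2|].
have mE2 : measurable E2 by exact: mabs.
(* On [A] the null loss is at most [U] and [Lhat] is within [cr] of it. *)
pose A := ~` (E1 `|` E2).
have mE12 : measurable (E1 `|` E2) by exact: measurableU.
have mA : measurable A by exact: measurableC.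
have kk0 : (k0 <= k)%N by clear -k18; lia.
have ltA : (model n (Param b 1%:M sigma0) A <= (1 / 4 + 1 / 10)%:E)%E.
  apply: (model_le_planted (hB := hB) (r := r) (lam := lam)) => // [|f].
    by rewrite /lam mulr_ge0 ?(ltW lp0)//; clear -g1; lra.
  set th := Param _ _ _.
  have thT : Theta M1 M2 k th.
    (* The planted vector has at most k0 + m = k nonzero entries, and its noise level is at most
       sigma0. *)
    apply: identity_in_Theta => //.
    - apply: leq_trans (l0norm_addspike _ _ _ _ _) _.
      by rewrite -(subnKC kk0) leq_add2r.
    - by rewrite mulr_gt0// sqrtr_gt0; clear -rm; lra.
    - apply: le_trans sM; rewrite -[leRHS]mulr1 ler_pM2l// -[leRHS]sqrtr1.
      by rewrite ler_sqrt// gerBl mulr_ge0 ?sqr_ge0.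
  apply: le_trans (sup _ thT); apply: le_measure; [exact: mem_set mA|exact: mem_set (mabs _)|].
  move=> z /not_orP[/negP]; rewrite -leNgt => gU /negP; rewrite -ltNge => Lg /=.
  have wD : lqnorm q (sigma0 *: spike hB r f) = D by apply: lqnorm_spike => //; exact: ltW.
  have uD : lqnorm q (betahat z - b) <= D / 5.
    rewrite -(ler_pXn2r (n := 2))// ?nnegrE ?lqnorm_ge0 ?divr_ge0 ?(ltW D0)//.
    by apply: le_trans gU _; apply: le_trans UD _; rewrite expr_div_n -natrX.
  have vD := lqnorm_separation q1 D0 wD uD.
  have v2 : D ^+ 2 / 16 <= lqnorm q (betahat z - (b + sigma0 *: spike hB r f)) ^+ 2.
    have -> : D ^+ 2 / 16 = (D / 4) ^+ 2 by rewrite expr_div_n -natrX.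
    rewrite opprD addrA ler_pXn2r// ?nnegrE ?lqnorm_ge0 ?divr_ge0 ?(ltW D0)//.
  exact: dist_gap gU UD Lg v2 crD D20.
set P := model n (Param b 1%:M sigma0) in hyp ltA.
have PE2 : (P E2 <= (1 / 4)%:E)%E.
  apply: (sup (Param b 1%:M sigma0)); apply: identity_in_Theta => //.
  by apply: leq_trans bk0 _.
have PE12 : (P (E1 `|` E2) <= (alpha0 + 1 / 4)%:E)%E.
  apply: le_trans (measureU2 P mE1 mE2) _.
  by rewrite EFinD; apply: leeD.
have PA : (P A = 1 - P (E1 `|` E2))%E by exact: probability_setC.
have fin12 : P (E1 `|` E2) \is a fin_num by exact: fin_num_measure.
(* 1 - (alpha0 + 1/4) > 1/2, against the upper bound 7/20. *)
move: ltA PE12; rewrite PA -(fineK fin12) -EFinB !lee_fin.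
move: (fine _) => x; clear -al1; lra.
Qed.


Theorem theorem2 (R : realType) (q alpha0 Cstar gamma sigma0 M1 M2 : R)
  (hq : 1 <= q <= 2) (halpha0 : 0 <= alpha0 < 1 / 4) (hCstar : 0 < Cstar)
  (hgamma : 0 <= gamma < 1 / 2) (hsigma0 : 0 < sigma0)
  (hM1 : 1 <= M1) (hM2 : 0 < M2) (hsigma0M2 : sigma0 <= M2) :
  exists delta c : R, [/\ 0 < delta, 0 < c &
    forall (alpha : R) (n p k k0 : nat),
      0 < alpha < 1 / 4 ->
      (0 < n)%N -> (0 < p)%N ->
      k%:R <= c0 alpha alpha0 Cstar gamma *
              Num.min (p%:R `^ gamma) (n%:R / ln p%:R) ->
      k0%:R <= c0 alpha alpha0 Cstar gamma *
               Num.min k%:R (Num.sqrt n%:R / ln p%:R) ->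
    forall betahat : 'M[R]_(n, p) * 'cV[R]_n -> 'cV[R]_p,
      measurable_fun setT betahat ->
      (exists theta0 : param p,
        [/\ Theta0 sigma0 k theta0, (l0norm (beta theta0) <= k0)%N &
          (model n theta0
             [set z | (Cstar * (l0norm (beta theta0))%:R `^ (2 / q) *
                         (ln p%:R / n%:R) * sigma0 ^+ 2 <
                       lqnorm q (betahat z - beta theta0) ^+ 2)%R]
           <= alpha0%:E)%E]) ->
      (delta%:E <=
       ereal_inf [set ereal_sup [set model n theta
            [set z | (c * k%:R `^ (2 / q) * (ln p%:R / n%:R) <=
                      `| Lhat z - lqnorm q (betahat z - beta theta) ^+ 2 |)%R]
              | theta in Theta M1 M2 k]
          | Lhat in [set Lhat : 'M[R]_(n, p) * 'cV[R]_n -> R |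
                      measurable_fun setT Lhat]])%E].
Proof.
have g1 : gamma < 1 / 2 by case/andP: hgamma.
have a1 : alpha0 < 1 / 4 by case/andP: halpha0.
exists (1 / 4), ((1 - 2 * gamma) * sigma0 ^+ 2 / 800); split.
- by rewrite divr_gt0.
- apply: mulr_gt0; last by rewrite invr_gt0 ltr0n.
  by apply: mulr_gt0; [lra|rewrite exprn_gt0].
move=> alpha n p k k0 halpha n0 p0 hk hk0 betahat mb [[b S s]] [[/= bk SE sE] bk0 hyp].
subst S s.
apply: le_ereal_inf_tmp => _ [Lhat mL <-]; rewrite leNgt; apply/negP => hsup.
have sup theta : Theta M1 M2 k theta -> (model n theta
    [set z | ((1 - 2 * gamma) * sigma0 ^+ 2 / 800 * k%:R `^ (2 / q) * (ln p%:R / n%:R) <=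
      `| Lhat z - lqnorm q (betahat z - beta theta) ^+ 2 |)%R] < (1 / 4)%:E)%E.
  by move=> hT; apply: le_lt_trans hsup; apply: ereal_sup_ubound; exists theta.
have [c18 Cc] := c0_bounds halpha halpha0 hCstar hgamma.
(* For k = 0 the threshold vanishes, since 2 / q is nonzero and so 0 ^ (2 / q) = 0; the event is
   then the whole space. *)
have [k00|kpos] := posnP k.
  have th0 : Theta M1 M2 k (Param b 1%:M sigma0) by exact: identity_in_Theta.
  have := sup _ th0; rewrite (_ : [set z | _] = setT).
    by apply/negP; rewrite -leNgt probability_setT lee_fin; lra.
  apply/seteqP; split=> z //= _; rewrite k00 powR0 ?mulr0 ?mul0r//.
  by rewrite mulf_neq0// ?invr_neq0// gt_eqF//; case/andP: hq => q1 _; apply: lt_le_trans q1.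
apply: (no_loss_estimator (k0 := k0) hq halpha0 hCstar hgamma hsigma0 hM1 hsigma0M2 c18 Cc
   n0 p0 kpos hk _ bk0 mb mL hyp) => [|theta hT]; last exact/ltW/sup.
apply: le_trans hk0 _.
(* A negative [c0] would contradict k > 0 through the bound on k, as the minimum there is
   nonnegative. *)
have c00 : 0 <= c0 alpha alpha0 Cstar gamma.
  rewrite leNgt; apply/negP => cneg; move: hk; apply/negP; rewrite -ltNge.
  apply: (@le_lt_trans _ _ 0); last by rewrite ltr0n.
  rewrite mulr_le0_ge0 ?(ltW cneg)// le_min powR_ge0 divr_ge0//.
  by rewrite ln_ge0// ler1n.
by rewrite ler_wpM2l// ge_min lexx.
Qed.
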